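(* Let $\kappa^+,\kappa^->0$, $\rho^\pm\in\mathbb{R}$ with $\rho^--\rho^+>0$ (Rayleigh–Taylor stable case), $h_2>0$ and $T>0$. Let $f\in C([0,T],H^3(\mathbb{T}))$ with $f>0$ be a smooth solution of the inhomogeneous Muskat equation $$ \partial_t f(x)=\frac{\kappa^+(\rho^--\rho^+)}{4\pi}\,\mathrm{P.V.}\!\int_{\mathbb{T}}\frac{\sin(\beta)(\partial_x f(x)-\partial_x f(x-\beta))}{\cosh(f(x)-f(x-\beta))-\cos(\beta)}\,d\beta+\frac{1}{4\pi}\,\mathrm{P.V.}\!\int_{\mathbb{T}}\frac{(\partial_x f(x)\sinh(f(x)+h_2)+\sin(x-\beta))\,\varpi_2(\beta)}{\cosh(f(x)+h_2)-\cos(x-\beta)}\,d\beta , $$ where $$ \varpi_2(\beta)=\mathcal{A}\,\mathrm{P.V.}\!\int_{\mathbb{T}}\frac{\sinh(h_2+f(\gamma))\,\partial_x f(\gamma)}{\cosh(h_2+f(\gamma))-\cos(\beta-\gamma)}\,d\gamma,\qquad \mathcal{A}=\frac{\kappa^+(\rho^--\rho^+)}{2\pi}\,\frac{\kappa^+-\kappa^-}{\kappa^++\kappa^-}. $$ Let $\langle f(x,0)\rangle=\frac{1}{2\pi}\int_{\mathbb{T}}f(x,0)\,dx$. Suppose that the initial data satisfies $$ \frac{1}{\cosh\!\big((\max_x f(x,0)-\min_x f(x,0))/2\big)}-\frac{8\left|\frac{\kappa^+-\kappa^-}{\kappa^++\kappa^-}\right|}{\pi^2\big(\cosh(h_2+\langle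 f(x,0)\rangle)-1\big)^3}\,\sinh\!\big(\langle f(x,0)\rangle+\max_x f(x,0)-\min_x f(x,0)+h_2\big)>0 $$ and, in addition, $$ \begin{aligned} 0>{}&-\frac{\kappa^+(\rho^--\rho^+)}{4}\|\partial_x f(0)\|_{L^\infty}\big(1-\mathcal{P}(\|\partial_x f(0)\|_{L^\infty})\big)+\pi|\mathcal{A}|\frac{\cosh(\|f(0)\|_{L^\infty}+h_2)}{(\cosh(h_2)-1)^2}\|\partial_x f(0)\|_{L^\infty}^2\\ &+2\pi|\mathcal{A}|\frac{\sinh^2(\|f(0)\|_{L^\infty}+h_2)}{(\cosh(h_2)-1)^3}\|\partial_x f(0)\|_{L^\infty}^2+2\pi|\mathcal{A}|\frac{\sinh(\|f(0)\|_{L^\infty}+h_2)}{(\cosh(h_2)-1)^3}\|\partial_x f(0)\|_{L^\infty}, \end{aligned} $$ with $$ \mathcal{P}(z)=\left[\frac{1}{\big(1-(\sinh(z\pi/2))^2\big)^2}-1\right]+\frac12 z\big(2\pi\cosh(\pi z)+\pi\sinh(\pi z)\big). $$ Then there exists a (sufficiently small) constant $\mu>0$, depending on the parameters $\kappa^\pm,\rho^\pm,h_2$ of the problem and the initial data $f(\cdot,0)$, such that for all $t\in[0,T]$ $$ \|\partial_x f(t)\|_{L^\infty}\le\|\partial_x f(0)\|_{L^\infty}e^{-\mu t}. $$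
   Context: $\mathbb{T}=[-\pi,\pi]$ with periodic boundary conditions; all functions of $x$ are real-valued and $2\pi$-periodic. $\mathrm{P.V.}$ denotes the Cauchy principal value. In the equation the time dependence is suppressed, $f(x)=f(x,t)$; $f(t)=f(\cdot,t)$. $H^3(\mathbb{T})$ is the usual $L^2$-based Sobolev space and $L^\infty=L^\infty(\mathbb{T})$. Physically, $f$ is the graph of the interface between two fluids with densities $\rho^+$ (above) and $\rho^-$ (below) in a porous medium whose permeability is $\kappa^+$ for $y>-h_2$ and $\kappa^-$ for $y<-h_2$. *)

(* Defs.v *)
From HB Require Import structures.
From mathcomp Require Import all_boot all_order all_algebra.
From mathcomp Require Import all_classical all_reals all_analysis.

Set Implicit Arguments.
Unset Strict Implicit.
Unset Printing Implicit Defensive.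

Import Order.TTheory GRing.Theory Num.Theory.
Import numFieldNormedType.Exports.

Local Open Scope classical_set_scope.
Local Open Scope ring_scope.

Definition cosh (R : realType) (x : R) : R := (expR x + expR (- x)) / 2.
Definition sinh (R : realType) (x : R) : R := (expR x - expR (- x)) / 2.

(* Functions on the torus T = [-pi, pi] are 2pi-periodic functions on R; norms
   and integrals over T only see their values on [-pi, pi]. *)
Definition torus (R : realType) : set R := `[- pi, pi]%classic.
Arguments torus : clear implicits.

Lemma measurable_torus (R : realType) :
  measurable (torus R : set (measurableTypeR R)).
Proof. exact: measurable_itv. Qed.

Definition torus_measure (R : realType) :
    {measure set measurableTypeR R -> \bar R} :=
  mrestr (@lebesgue_measure R) (@measurable_torus R).
Arguments torus_measure : clear implicits.

Definition torus_int (R : realType) (g : R -> R) : R :=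
  \int[@lebesgue_measure R]_(x in torus R) g x.

(* Real-valued, so only meaningful on functions of finite norm. *)
Definition torus_norm (R : realType) (p : \bar R) (g : R -> R) : R :=
  fine ('N[torus_measure R]_p[EFin \o g])%E.

Definition normLoo (R : realType) (g : R -> R) : R := torus_norm +oo%E g.

Definition L2 (R : realType) (g : R -> R) : Prop :=
  finite_norm (torus_measure R) 2%:E g /\ measurable_fun setT g.

(* Enlarging the class of test functions from C^oo to C^1 does not change the
   notion of weak derivative. *)
Definition weak_derivative (R : realType) (u v : R -> R) : Prop :=
  forall phi : R -> R,
    periodic phi (pi *+ 2) ->
    (forall x, derivable phi x 1) -> continuous (derive1 phi) ->
    torus_int (fun x => u x * derive1 phi x) = - torus_int (fun x => v x * phi x).

(* D 0 = u, D 1, .., D m are the weak derivatives of u up to order m, all in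
   L^2(T); u belongs to H^m(T) iff such a D exists, and then D 1, .., D m are
   unique almost everywhere on T. *)
Definition sobolev_jet (R : realType) (m : nat) (u : R -> R)
    (D : nat -> R -> R) : Prop :=
  [/\ D 0%N = u,
      forall k, (k <= m)%N -> L2 (D k) &
      forall k, (k < m)%N -> weak_derivative (D k) (D k.+1)].

Definition sobolev_norm (R : realType) (m : nat) (D : nat -> R -> R) : R :=
  Num.sqrt (\sum_(k < m.+1) torus_norm 2%:E (D k) ^+ 2).

(* f in C([0, T], H^m(T)) *)
Definition continuous_in_sobolev (R : realType) (m : nat) (T : R)
    (f : R -> R -> R) : Prop :=
  exists D : R -> nat -> R -> R,
    (forall t, t \in `[0, T] -> sobolev_jet m (f t) (D t)) /\
    (forall t, t \in `[0, T] ->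
       (fun s => sobolev_norm m (fun k x => D s k x - D t k x))
         @ within `[0, T]%classic (nbhs t) --> (0 : R)).

(* Principal value over T of a 2pi-periodic g with a singularity at c: by
   periodicity the integral over T is taken over [c - pi, c + pi], from which
   the ball of radius e around c is removed. *)
Definition pv (R : realType) (c : R) (g : R -> R) : R :=
  lim ((fun e : R =>
          \int[@lebesgue_measure R]_(s in [set s | e < `|s| <= pi]) g (c + s))
       @ 0^'+).

Definition atwood (R : realType) (kp km : R) : R := (kp - km) / (kp + km).

Definition calA (R : realType) (kp km rp rm : R) : R :=
  kp * (rm - rp) / (2 * pi) * atwood kp km.

(* The vorticity strength at the permeability jump; here u = f(., t). *)
Definition varpi2 (R : realType) (kp km rp rm h2 : R) (u : R -> R) (b : R) : R :=
  calA kp km rp rm *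
  pv b (fun g => sinh (h2 + u g) * derive1 u g / (cosh (h2 + u g) - cos (b - g))).

Definition muskat_rhs (R : realType) (kp km rp rm h2 : R) (u : R -> R) (x : R)
    : R :=
  kp * (rm - rp) / (4 * pi) *
  pv 0 (fun b => sin b * (derive1 u x - derive1 u (x - b)) /
                 (cosh (u x - u (x - b)) - cos b))
  + (4 * pi)^-1 *
  pv x (fun b => (derive1 u x * sinh (u x + h2) + sin (x - b)) *
                 varpi2 kp km rp rm h2 u b /
                 (cosh (u x + h2) - cos (x - b))).

(* f t x is the height of the interface above x at time t; values at times
   outside [0, T] are irrelevant.  The solution is classical: C^1 in x on
   [0, T], with a time derivative jointly continuous on ]0, T[ x R.  Since
   H^3(T) embeds in C^2(T), this is no restriction: it selects the continuous
   representative and makes the equation meaningful pointwise. *)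
Record smooth_muskat_solution (R : realType) (kp km rp rm h2 T : R)
    (f : R -> R -> R) : Prop := SmoothMuskatSolution {
  muskat_periodic : forall t, t \in `[0, T] -> periodic (f t) (pi *+ 2);
  muskat_sobolev : continuous_in_sobolev 3 T f;
  muskat_derivable_x : forall t x, t \in `[0, T] -> derivable (f t) x 1;
  muskat_continuous_dx : forall t, t \in `[0, T] -> continuous (derive1 (f t));
  muskat_derivable_t : forall t x, t \in `]0, T[ -> derivable (f ^~ x) t 1;
  muskat_continuous_dt : forall t x, t \in `]0, T[ ->
    {for (t, x), continuous (fun p : R * R => derive1 (f ^~ p.2) p.1)};
  muskat_equation : forall t x, t \in `]0, T[ ->
    derive1 (f ^~ x) t = muskat_rhs kp km rp rm h2 (f t) x }.

Definition mean (R : realType) (u : R -> R) : R := (2 * pi)^-1 * torus_int u.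

(* max u - min u; the supremum and infimum of a continuous periodic function
   are attained. *)
Definition oscillation (R : realType) (u : R -> R) : R :=
  sup (range u) - inf (range u).

(* At sinh (z * pi / 2) = 1, where the formula is singular, the convention
   0^-1 = 0 still gives calP z > 1. *)
Definition calP (R : realType) (z : R) : R :=
  (((1 - sinh (z * pi / 2) ^+ 2) ^+ 2)^-1 - 1)
  + 2^-1 * z * (2 * pi * cosh (pi * z) + pi * sinh (pi * z)).

Definition amplitude_condition (R : realType) (kp km h2 : R) (u : R -> R)
    : Prop :=
  0 < (cosh (oscillation u / 2))^-1
      - 8 * `|atwood kp km| / (pi ^+ 2 * (cosh (h2 + mean u) - 1) ^+ 3)
        * sinh (mean u + oscillation u + h2).

Definition slope_condition (R : realType) (kp km rp rm h2 : R) (u : R -> R)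
    : Prop :=
  let M := normLoo u in
  let z := normLoo (derive1 u) in
  let a := `|calA kp km rp rm| in
  - (kp * (rm - rp) / 4) * z * (1 - calP z)
  + pi * a * (cosh (M + h2) / (cosh h2 - 1) ^+ 2) * z ^+ 2
  + 2 * pi * a * (sinh (M + h2) ^+ 2 / (cosh h2 - 1) ^+ 3) * z ^+ 2
  + 2 * pi * a * (sinh (M + h2) / (cosh h2 - 1) ^+ 3) * z < 0.

(* Main.v *)
Require Import Defs.
From mathcomp Require Import all_boot all_order all_algebra.
From mathcomp Require Import all_classical all_reals all_analysis.
From mathcomp Require Import measurable_realfun ess_sup_inf ring lra.

Import Order.TTheory GRing.Theory Num.Theory.
Import numFieldNormedType.Exports.

Local Open Scope classical_set_scope.
Local Open Scope ring_scope.

Set Implicit Arguments.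
Unset Strict Implicit.
Unset Printing Implicit Defensive.

(** The slope is controlled through the increments w(x) = f(t, x + h) - f(t, x)
    with a fixed small h: their extrema are attained, and only one space
    derivative of f is ever differentiated in time.  At a maximum point x of w
    one has f'(x + h) = f'(x).  Integrating the difference of the singular
    integrals at x + h and x by parts leaves an integral of
    w(x) - w(x - b) >= 0 against a kernel which, for small slopes, is at most
    - damping / 2; since w has mean zero this gives a decay rate proportional
    to w(x).  The difference of the permeability jump terms is at most a constant
    times |h| times the slope, by the mean value theorem in x, because the kernel
    is the gradient of a logarithm whose second derivatives are bounded by the
    kernel itself, and because the vorticity is bounded by the slope.  The slope
    condition says precisely that the first effect wins, whatever the amplitude
    of f.  Comparing with exp (- mu t), a first time at which the slope exceeds
    the claimed bound is excluded once h is small.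

    That a solution in C([0, T], H^3) has a slope continuous in time, uniformly
    in x, and Lipschitz in x, uniformly in time, is seen by testing the third
    weak derivative against a smoothed Green function of the second derivative
    on the torus. *)

(** * Calculus *)

(** The rate [mu] has to be fixed before [T] and the solution are known, whereas the step h may
    depend on both: the Lipschitz constant of the slope and the final time enter only through errors
    of relative order h. What makes the comparison work is that the sup norm N of the increment and
    the slope control each other: N is at most h times the slope, and h times the slope is at most N
    plus a term of order h^2. The loss in the second bound is paid for by letting the slope climb to
    a level slightly above its initial value; since the rate is continuous in the slope, it still
    exceeds [mu] there. An extremum of the increment serves twice. Equality of the slopes at x and x
    + h keeps second derivatives of f out of the difference of the jump terms, and the quadratic
    vanishing of w(x) - w(x - b) at b = 0 removes the boundary term at the singularity. The rate
    itself arises as follows: the integral of w(x) - w(x - b) over the torus is 2 pi w(x), so the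
    kernel bound gives pi times [damping], and the prefactor 1/(4 pi) leaves a quarter. *)

Section Calculus.
Context {R : realType}.
Implicit Types (f g : R -> R) (x y a b : R).

(* A plain constant: [is_derive] is a type class, whose resolution would be
   triggered at every side condition. *)
Definition deriv_at f x a : Prop := is_derive x 1 f a.

Lemma deriv_atD f g x a b : deriv_at f x a -> deriv_at g x b ->
  deriv_at (fun y => f y + g y) x (a + b).
Proof. exact: is_deriveD. Qed.

Lemma deriv_atB f g x a b : deriv_at f x a -> deriv_at g x b ->
  deriv_at (fun y => f y - g y) x (a - b).
Proof. exact: is_deriveB. Qed.

Lemma deriv_atN f x a : deriv_at f x a ->
  deriv_at (fun y => - f y) x (- a).
Proof. exact: is_deriveN. Qed.

Lemma deriv_at_cst (c x : R) : deriv_at (fun _ : R => c : R) x 0.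
Proof. exact: is_derive_cst. Qed.

Lemma deriv_at_id x : deriv_at (fun y : R => y : R) x 1.
Proof. exact: is_derive_id. Qed.

Lemma deriv_atM f g x a b : deriv_at f x a -> deriv_at g x b ->
  deriv_at (fun y => f y * g y) x (a * g x + f x * b).
Proof.
move=> fa gb; have := is_deriveM fa gb.
by rewrite /GRing.scale/= addrC (mulrC a).
Qed.

Lemma deriv_atV f x a : f x != 0 -> deriv_at f x a ->
  deriv_at (fun y => (f y)^-1) x (- a / f x ^+ 2).
Proof.
move=> f0 fa; have := is_deriveV f0 fa.
by rewrite /GRing.scale/= mulrC mulrN mulNr.
Qed.

Lemma deriv_at_div f g x a b : g x != 0 ->
  deriv_at f x a -> deriv_at g x b ->
  deriv_at (fun y => f y / g y) x ((a * g x - f x * b) / g x ^+ 2).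
Proof.
move=> g0 fa gb; have := deriv_atM fa (deriv_atV g0 gb).
by congr is_derive; field.
Qed.

Lemma deriv_at_comp f g x a b : deriv_at f (g x) a ->
  deriv_at g x b -> deriv_at (fun y => f (g y)) x (a * b).
Proof. exact: is_derive1_comp. Qed.

Lemma deriv_at_continuous f x a : deriv_at f x a -> {for x, continuous f}.
Proof.
by case=> /derivable1_diffP/differentiable_continuous.
Qed.

Lemma deriv_at_shift f x a c : deriv_at f (x + c) a ->
  deriv_at (fun y => f (y + c)) x a.
Proof.
move=> fa; rewrite -[a]mulr1; apply: (@deriv_at_comp f (fun y => y + c)) => //.
by have := deriv_atD (deriv_at_id x) (deriv_at_cst c x); rewrite addr0.
Qed.

Lemma deriv_at_reflect f x a c : deriv_at f (c - x) a ->
  deriv_at (fun y => f (c - y)) x (- a).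
Proof.
move=> fa; rewrite -[a]mulr1 -mulrN.
apply: (@deriv_at_comp f (fun y => c - y)) => //.
by have := deriv_atB (deriv_at_cst c x) (deriv_at_id x); rewrite sub0r.
Qed.

Lemma derivable_deriv_at f x : derivable f x 1 -> deriv_at f x (derive1 f x).
Proof. by move=> df; rewrite derive1E; apply: DeriveDef. Qed.

Lemma derive1_deriv_at f x a : deriv_at f x a -> derive1 f x = a.
Proof. by case=> _ <-; rewrite derive1E. Qed.

Lemma mean_value f (df : R -> R) a b : (forall x, deriv_at f x (df x)) ->
  a <= b -> exists c, [/\ a <= c, c <= b & f b - f a = df c * (b - a)].
Proof.
move=> fdf ab.
have cf : {within `[a, b], continuous f}.
  by apply: continuous_subspaceT => x; apply: deriv_at_continuous (fdf x).
have [c] := MVT_segment ab (fun x _ => fdf x) cf.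
by rewrite in_itv/= => /andP[ac cb] e; exists c.
Qed.

Lemma lipschitz_of_derive f (df : R -> R) K :
  (forall x, deriv_at f x (df x)) -> (forall x, `|df x| <= K) ->
  forall a b, `|f b - f a| <= K * `|b - a|.
Proof.
move=> fdf dfK a b; wlog ab : a b / a <= b.
  move=> H; have [/H//|/ltW/H] := leP a b.
  by rewrite distrC [X in _ <= _ * X]distrC.
have [c [_ _ ->]] := mean_value fdf ab.
by rewrite normrM ler_wpM2r.
Qed.

Lemma deriv_at_eps f x a : deriv_at f x a -> forall e, 0 < e ->
  exists2 d, 0 < d & forall h, `|h| < d -> `|f (x + h) - f x - a * h| <= e * `|h|.
Proof.
move=> [df <-] e e0.
have /cvgrPdist_le/(_ e e0) := df.
move=> [d /= d0 H]; exists d => // h hd.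
have [->|h0] := eqVneq h 0; first by rewrite addr0 mulr0 !subrr normr0 mulr0.
have := H h; rewrite /= sub0r normrN => /(_ hd h0).
rewrite [_%:A]mulr1 /GRing.scale/= distrC => H1.
rewrite (_ : _ - _ - _ = h * (h^-1 * (f (h + x) - f x) - 'D_1 f x)).
  by rewrite normrM mulrC ler_wpM2r.
by rewrite mulrBr mulrA divff// mul1r [h + x]addrC [h * _]mulrC.
Qed.

(** One-sided on purpose: in time the weighted increment is known to be maximal only over the past
    of the point considered. *)
Lemma deriv_at_left_max f x a b : deriv_at f x a -> b < x ->
  (forall y, b <= y <= x -> f y <= f x) -> 0 <= a.
Proof.
move=> fa bx fmax; rewrite leNgt; apply/negP => a0.
have e0 : 0 < - a / 2 by rewrite divr_gt0// oppr_gt0.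
have [d d0 H] := deriv_at_eps fa e0.
pose h := Num.min (d / 2) (x - b).
have h0 : 0 < h by rewrite lt_min divr_gt0//= subr_gt0.
have hd : h <= d / 2 by rewrite ge_min lexx.
have hb : h <= x - b by rewrite ge_min lexx orbT.
have := H (- h); rewrite normrN gtr0_norm// => /(_ _)/wrap[].
  by rewrite (le_lt_trans hd)// ltr_pdivrMr// ltr_pMr// ltr1n.
rewrite ler_norml => /andP[H1 _].
have := fmax (x - h); rewrite lerBrDl -lerBrDr hb/= gerBl ltW// => /(_ isT).
nra.
Qed.

Lemma deriv_at_max f x a : deriv_at f x a -> (forall y, f y <= f x) -> a = 0.
Proof.
move=> fa fmax; apply/eqP; rewrite eq_le; apply/andP; split; last first.
  by apply: (deriv_at_left_max fa (b := x - 1)) => //; rewrite ltrBlDr ltrDl.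
rewrite -oppr_ge0.
have fr : deriv_at (fun y => f (0 - y)) (- x) (- a).
  by apply: deriv_at_reflect; rewrite opprK add0r.
apply: (deriv_at_left_max fr (b := - x - 1)); first by rewrite ltrBlDr ltrDl.
by move=> y _; rewrite !sub0r opprK.
Qed.

(** A concave function vanishing at 0 lies above its chord. Applied to the sine it yields Jordan's
    inequality, applied to - sinh it yields [sinh_scale]. *)
Lemma chord_le f (df : R -> R) x b : (forall x, deriv_at f x (df x)) ->
  f 0 = 0 -> 0 <= x -> x <= b ->
  (forall y z, 0 <= y -> y <= z -> z <= b -> df z <= df y) ->
  x * f b <= b * f x.
Proof.
move=> fdf f0 x0 xb mono.
have [c [c0 cx]] := mean_value fdf x0; rewrite f0 !subr0 => fx.
have [d [xd db]] := mean_value fdf xb => fb.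
have : (f b - f x) * x <= f x * (b - x).
  rewrite fb fx -[X in X <= _]mulrA -[X in _ <= X]mulrA [x * _]mulrC.
  rewrite ler_wpM2r ?mulr_ge0 ?subr_ge0//.
  by apply: mono => //; exact: le_trans xd.
lra.
Qed.
End Calculus.

(** * Hyperbolic functions *)

Section Hyperbolic.
Context {R : realType}.
Implicit Types x y z : R.

Lemma deriv_at_cosh x : deriv_at (@cosh R) x (sinh x).
Proof.
have eN : deriv_at (fun y => expR (- y)) x (- expR (- x)).
  rewrite -[expR (- x)]mulr1 -mulrN; apply: (@deriv_at_comp _ expR (fun y => - y)).
    exact: is_derive_expR.
  exact/deriv_atN/deriv_at_id.
have := deriv_atM (deriv_atD (is_derive_expR x) eN) (deriv_at_cst 2^-1 x).
by rewrite mulr0 addr0.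
Qed.

Lemma deriv_at_sinh x : deriv_at (@sinh R) x (cosh x).
Proof.
have eN : deriv_at (fun y => expR (- y)) x (- expR (- x)).
  rewrite -[expR (- x)]mulr1 -mulrN; apply: (@deriv_at_comp _ expR (fun y => - y)).
    exact: is_derive_expR.
  exact/deriv_atN/deriv_at_id.
have := deriv_atM (deriv_atB (is_derive_expR x) eN) (deriv_at_cst 2^-1 x).
by rewrite mulr0 addr0 opprK.
Qed.

Lemma sinh0 : sinh (0 : R) = 0.
Proof. by rewrite /sinh oppr0 subrr mul0r. Qed.

Lemma sinhN x : sinh (- x) = - sinh x.
Proof. by rewrite /sinh opprK -mulNr opprB. Qed.

Lemma coshN x : cosh (- x) = cosh x.
Proof. by rewrite /cosh opprK addrC. Qed.

Lemma cosh2B1 x : cosh x ^+ 2 - sinh x ^+ 2 = 1.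
Proof.
have : expR x * expR (- x) = 1 by rewrite -expRD subrr expR0.
rewrite /cosh /sinh; set a := expR x; set b := expR (- x) => ab.
transitivity (a * b) => //; by field.
Qed.

Lemma cosh_gt0 x : 0 < cosh x.
Proof. by rewrite divr_gt0// addr_gt0// expR_gt0. Qed.

Lemma cosh_ge1 x : 1 <= cosh x.
Proof. have := cosh2B1 x; have := cosh_gt0 x; nra. Qed.

Lemma sinh_homo x y : x <= y -> sinh x <= sinh y.
Proof.
move=> xy; have [c [_ _]] := mean_value deriv_at_sinh xy.
have := cosh_gt0 c; nra.
Qed.

Lemma sinh_ge0 x : 0 <= x -> 0 <= sinh x.
Proof. by move=> x0; rewrite -sinh0 sinh_homo. Qed.

Lemma sinh_ge x : 0 <= x -> x <= sinh x.
Proof.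
move=> x0; have [c [_ _]] := mean_value deriv_at_sinh x0.
rewrite sinh0 !subr0 => ->; have := cosh_ge1 c; nra.
Qed.

Lemma sinh_gt0 x : 0 < x -> 0 < sinh x.
Proof. by move=> x0; rewrite (lt_le_trans x0)// sinh_ge// ltW. Qed.

Lemma cosh_homo x y : 0 <= x -> x <= y -> cosh x <= cosh y.
Proof.
move=> x0 xy; have [c [xc _]] := mean_value deriv_at_cosh xy.
have := sinh_ge0 (le_trans x0 xc); nra.
Qed.

Lemma cosh_gt1 x : 0 < x -> 1 < cosh x.
Proof. move=> /sinh_gt0; have := cosh2B1 x; have := cosh_gt0 x; nra. Qed.

Lemma sinh_norm_le x y : `|x| <= y -> `|sinh x| <= sinh y.
Proof.
by rewrite !ler_norml => /andP[/sinh_homo + /sinh_homo ->]; rewrite sinhN => ->.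
Qed.

Lemma sinh_le_cosh x : 0 <= x -> sinh x <= x * cosh x.
Proof.
move=> x0; have [c [c0 cx]] := mean_value deriv_at_sinh x0.
rewrite sinh0 !subr0 => ->.
by rewrite mulrC ler_wpM2l// cosh_homo.
Qed.

Lemma sinh_lt_cosh x : sinh x < cosh x.
Proof.
rewrite /sinh /cosh ltr_pM2r ?invr_gt0//.
have := expR_gt0 (- x); lra.
Qed.

Lemma coshD x y : cosh (x + y) = cosh x * cosh y + sinh x * sinh y.
Proof. by rewrite /cosh /sinh opprD !expRD; field. Qed.

Lemma sinhD x y : sinh (x + y) = sinh x * cosh y + cosh x * sinh y.
Proof. by rewrite /cosh /sinh opprD !expRD; field. Qed.

Lemma cosh_half x : cosh x = 1 + 2 * sinh (x / 2) ^+ 2.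
Proof.
have {1}-> : x = x / 2 + x / 2 by field.
rewrite coshD; have := cosh2B1 (x / 2); nra.
Qed.

Lemma sinh_half x : sinh x = 2 * sinh (x / 2) * cosh (x / 2).
Proof.
have {1}-> : x = x / 2 + x / 2 by field.
by rewrite sinhD; ring.
Qed.

(** Extracts the factor |sin (b / 2)| from sinh of a quantity of size |b|, so that it cancels
    against the denominator of the singular kernel. *)
Lemma sinh_scale s x : 0 <= s -> s <= 1 -> 0 <= x -> sinh (s * x) <= s * sinh x.
Proof.
move=> s0 s1 x0; have [->|xn0] := eqVneq x 0; first by rewrite mulr0 sinh0 mulr0.
have xp : 0 < x by rewrite lt0r xn0.
have sx0 : 0 <= s * x by rewrite mulr_ge0.
have sx1 : s * x <= x by rewrite ler_piMl.
have := @chord_le R (fun y => - sinh y) (fun y => - cosh y) (s * x) x.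
move=> /(_ (fun y => deriv_atN (deriv_at_sinh y))).
rewrite sinh0 oppr0 => /(_ erefl sx0 sx1)/(_ _)/wrap[|].
  by move=> y z y0 yz _; rewrite lerN2 cosh_homo.
by rewrite !mulrN lerN2 [s * x]mulrC -mulrA ler_pM2l.
Qed.

Lemma cosh_diff_le x y m : `|x| <= m -> `|y| <= m ->
  `|cosh x - cosh y| <= sinh m * `|x - y|.
Proof.
wlog xy : x y / y <= x.
  move=> H xm ym; have [/H->//|/ltW/H] := leP y x.
  by rewrite distrC [X in _ <= _ * X]distrC; exact.
move=> xm ym; have [c [yc cx ->]] := mean_value deriv_at_cosh xy.
rewrite normrM ler_wpM2r// sinh_norm_le// ler_norml.
move: xm ym; rewrite !ler_norml => /andP[_ xm] /andP[ym _].
by rewrite (le_trans ym yc) (le_trans cx xm).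
Qed.

End Hyperbolic.

(** * Trigonometric bounds *)

Section Trigo.
Context {R : realType}.
Implicit Types x y z : R.

Lemma cos_half x : cos x = 1 - 2 * sin (x / 2) ^+ 2.
Proof.
have {1}-> : x = (x / 2) *+ 2 by rewrite -mulr_natr; field.
by rewrite cos_mulr2n cos2sin2; ring.
Qed.

Lemma sin_half x : sin x = 2 * sin (x / 2) * cos (x / 2).
Proof.
have {1}-> : x = (x / 2) *+ 2 by rewrite -mulr_natr; field.
by rewrite sin_mulr2n; ring.
Qed.

Lemma sin_norm_le x : `|sin x| <= `|x|.
Proof.
have := lipschitz_of_derive (@is_derive_sin R) (@cos_max R) 0 x.
by rewrite sin0 !subr0 mul1r.
Qed.

(** sin (pi / 4)^2 = 1/2 and |sin y| <= |y| give pi >= 2 sqrt 2. The value 12/5 is what the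
    comparison of [damping] with [calP] requires. *)
Lemma pi_gt_12_5 : 12 / 5 < pi :> R.
Proof.
rewrite ltNge; apply/negP => pile.
have := @cos_half (pi / 2); rewrite cos_pihalf.
have := sin_norm_le (pi / 2 / 2); have := pi_ge2 R => pi2.
rewrite [X in _ <= X]ger0_norm ?divr_ge0// ?(le_trans _ pi2)// => /ler_normlP[].
nra.
Qed.

Lemma jordan x : `|x| <= pi -> `|x| <= pi * `|sin (x / 2)|.
Proof.
wlog x0 : x / 0 <= x.
  move=> H; have [/H//|/ltW x0] := leP 0 x.
  by have := H (- x); rewrite oppr_ge0 normrN mulNr sinN normrN; exact.
rewrite ger0_norm// => xpi.
have x2 : 0 <= x / 2 by rewrite divr_ge0.
have x2p : x / 2 <= pi / 2 by rewrite ler_pM2r.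
have := chord_le (@is_derive_sin R) (@sin0 R) x2 x2p.
move=> /(_ _)/wrap[|].
  move=> y z y0 yz zp; have [->//|yz'] := eqVneq y z.
  have lpi (t : R) : t <= pi / 2 -> t <= pi by have := pi_ge0 R; lra.
  rewrite ltW// ltr_cos ?in_itv/= ?y0 ?lpi ?(le_trans yz)// ?(le_trans y0)//.
  by rewrite lt_neqAle yz' yz.
rewrite sin_pihalf mulr1 => H.
apply: (le_trans (y := pi * sin (x / 2))); last first.
  by rewrite ler_wpM2l ?pi_ge0 ?ler_norm.
lra.
Qed.

End Trigo.

Section ContinuityAt.
Context {R : realType}.
Implicit Types (f g : R -> R) (x : R).

Lemma continuous_atD f g x : {for x, continuous f} -> {for x, continuous g} ->
  {for x, continuous (fun y => f y + g y)}.
Proof. exact: cvgD. Qed.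

Lemma continuous_atB f g x : {for x, continuous f} -> {for x, continuous g} ->
  {for x, continuous (fun y => f y - g y)}.
Proof. exact: cvgB. Qed.

Lemma continuous_atM f g x : {for x, continuous f} -> {for x, continuous g} ->
  {for x, continuous (fun y => f y * g y)}.
Proof. exact: cvgM. Qed.

Lemma continuous_atV f x : f x != 0 -> {for x, continuous f} ->
  {for x, continuous (fun y => (f y)^-1)}.
Proof. exact: cvgV. Qed.

Lemma continuous_at_comp f g x : continuous f -> {for x, continuous g} ->
  {for x, continuous (fun y => f (g y))}.
Proof. by move=> cf cg; apply: continuous_comp => //; exact: cf. Qed.

Lemma continuous_at_cst c x : {for x, continuous (fun _ : R => c : R)}.
Proof. exact: cvg_cst. Qed.

Lemma continuous_at_reflect f c x : continuous f ->
  {for x, continuous (fun y => f (c - y))}.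
Proof.
move=> cf; apply: continuous_at_comp => //.
by apply: continuous_atB; [exact: continuous_at_cst|exact: cvg_id].
Qed.

Lemma continuous_at_shift f c x : continuous f ->
  {for x, continuous (fun y => f (c + y))}.
Proof.
move=> cf; apply: (@continuous_at_comp f (fun y => c + y)) => //.
by apply: continuous_atD; [exact: continuous_at_cst|exact: cvg_id].
Qed.

Lemma continuous_cosh : continuous (@cosh R).
Proof. by move=> x; exact: deriv_at_continuous (deriv_at_cosh x). Qed.

Lemma continuous_sinh : continuous (@sinh R).
Proof. by move=> x; exact: deriv_at_continuous (deriv_at_sinh x). Qed.

Lemma continuous_funD (f g : R -> R) : continuous f -> continuous g ->
  continuous (fun x => f x + g x).
Proof. by move=> cf cg x; exact: (continuous_atD (cf x) (cg x)). Qed.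

Lemma continuous_funB (f g : R -> R) : continuous f -> continuous g ->
  continuous (fun x => f x - g x).
Proof. by move=> cf cg x; exact: (continuous_atB (cf x) (cg x)). Qed.

Lemma continuous_funM (f g : R -> R) : continuous f -> continuous g ->
  continuous (fun x => f x * g x).
Proof. by move=> cf cg x; exact: (continuous_atM (cf x) (cg x)). Qed.

Lemma continuous_fun_comp (f g : R -> R) : continuous f -> continuous g ->
  continuous (fun x => f (g x)).
Proof. by move=> cf cg x; exact: (continuous_at_comp cf (cg x)). Qed.

Lemma continuous_fun_cst (c : R) : continuous (fun _ : R => c).
Proof. by move=> x; exact: continuous_at_cst. Qed.

Lemma continuous_funBr (f : R -> R) c : continuous f -> continuous (fun x => f (x - c)).
Proof.
move=> cf; rewrite (_ : (fun x => _) = (fun x => f (- c + x))).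
  by move=> x; exact: continuous_at_shift.
by apply/funext => x; rewrite addrC.
Qed.

Lemma derive_continuous f (df : R -> R) : (forall x, deriv_at f x (df x)) -> continuous f.
Proof. by move=> fE x; exact: deriv_at_continuous (fE x). Qed.

Lemma lipschitz_continuous (f : R -> R) (K : R) :
  (forall x y, `|f x - f y| <= K * `|x - y|) -> continuous f.
Proof.
move=> fK x; apply/cvgrPdist_le => e e0.
have K1 : 0 < `|K| + 1 by have := normr_ge0 K; lra.
have d0 : 0 < e / (`|K| + 1) by rewrite divr_gt0.
apply/nbhs_ballP; exists (e / (`|K| + 1)) => //= y xy.
have {}xy : `|x - y| < e / (`|K| + 1) by exact: xy.
apply: le_trans (fK x y) _; move: xy; rewrite ltr_pdivlMr//.
have := ler_norm K; have := normr_ge0 (x - y); nra.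
Qed.

End ContinuityAt.

(** Stands in for the limit e -> 0 when an interval of radius e around the singularity is cut out at
    a cost linear in e. *)
Lemma le_of_addeps (R : realType) (x y c d : R) : 0 <= c -> 0 < d ->
  (forall e, 0 < e -> e < d -> x <= y + c * e) -> x <= y.
Proof.
move=> c0 d0 H; apply/ler_addgt0Pr => eps eps0.
pose e := Num.min (d / 2) (eps / (c + 1)).
have c1 : 0 < c + 1 by lra.
have e0 : 0 < e by rewrite lt_min !divr_gt0.
have ed : e <= d / 2 by rewrite ge_min lexx.
have ee : e <= eps / (c + 1) by rewrite ge_min lexx orbT.
apply: le_trans (H e e0 _) _; first by lra.
by move: ee; rewrite ler_pdivlMr//; nra.
Qed.

(** * Integration over the torus *)

Section Integration.
Context {R : realType}.
Implicit Types (f g F : R -> R) (a b c x y : R).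
Notation mu := (@lebesgue_measure R).

Lemma continuous_integrable f a b : continuous f ->
  mu.-integrable `[a, b] (EFin \o f).
Proof.
move=> cf; apply: continuous_compact_integrable; first exact: segment_compact.
exact: continuous_subspaceT.
Qed.

Lemma FTC_Rintegral_in f F a b : a <= b ->
  (forall x, a <= x <= b -> deriv_at F x (f x)) ->
  (forall x, a <= x <= b -> {for x, continuous f}) ->
  \int[mu]_(x in `[a, b]) f x = F b - F a.
Proof.
rewrite le_eqVlt => /predU1P[-> _ _|ab Ff cf].
  by rewrite set_itv1 Rintegral_set1 subrr.
have abW : a <= b by exact: ltW.
have cF x : a <= x <= b -> {for x, continuous F}.
  by move=> xab; exact: deriv_at_continuous (Ff x xab).
rewrite /Rintegral (@continuous_FTC2 _ f F)//.
- apply: continuous_in_subspaceT => x; rewrite inE/= in_itv/=; exact: cf.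
- split.
  + move=> x; rewrite in_itv/= => /andP[ax xb].
    by case: (Ff x _) => //; rewrite !ltW.
  + by apply: cvg_at_right_filter; apply: cF; rewrite lexx.
  + by apply: cvg_at_left_filter; apply: cF; rewrite lexx abW.
- move=> x; rewrite in_itv/= => /andP[ax xb]; apply: derive1_deriv_at.
  by apply: Ff; rewrite !ltW.
Qed.

Lemma FTC_Rintegral f F a b : (forall x, deriv_at F x (f x)) ->
  continuous f -> a <= b -> \int[mu]_(x in `[a, b]) f x = F b - F a.
Proof. by move=> Ff cf ab; apply: FTC_Rintegral_in => // x _; exact: cf. Qed.

Lemma Rintegral_itv_split f a b c : a <= b -> b <= c ->
  mu.-integrable `[a, c] (EFin \o f) ->
  \int[mu]_(x in `[a, c]) f x =
  \int[mu]_(x in `[a, b]) f x + \int[mu]_(x in `[b, c]) f x.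
Proof.
move=> ab bc fi.
have fbc : mu.-integrable `]b, c] (EFin \o f).
  by apply: integrableS fi => //; apply: subset_itvr; rewrite bnd_simp.
have := Rintegral_itvB fi (x := b); rewrite !bnd_simp => /(_ ab bc).
rewrite Rintegral_itv_obnd_cbnd// => <-; ring.
Qed.

(** Integrals over [[a, x]] require a base point to the left of both 0 and x, so the base point
    moves with x; by additivity the value does not depend on it. *)
Lemma continuous_primitive f : continuous f ->
  exists F, forall x, deriv_at F x (f x).
Proof.
move=> cf; pose F x := \int[mu]_(t in `[- `|x| - 1, x]) f t
                     - \int[mu]_(t in `[- `|x| - 1, 0]) f t.
have FE a x : a <= 0 -> a <= x -> - `|x| - 1 <= a ->
    F x = \int[mu]_(t in `[a, x]) f t - \int[mu]_(t in `[a, 0]) f t.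
  move=> a0 ax xa; rewrite /F (Rintegral_itv_split xa ax); last first.
    exact: continuous_integrable.
  rewrite (Rintegral_itv_split xa a0); last exact: continuous_integrable.
  by ring.
(* Near x the base point can be frozen: for y within 1/3 of x, this a lies to the left of y and of
   0, and to the right of the base point - |y| - 1. *)
exists F => x; pose a : R := - `|x| - 3^-1.
have xN : - `|x| <= x by rewrite lerNl -normrN ler_norm.
have xa : a < x by rewrite /a; lra.
have x1 : x < x + 1 by rewrite ltrDl.
have [boundary_derive Fx] := @continuous_FTC1_closed R f a x (x + 1)
  x1 (continuous_integrable _ _ cf) xa (cf x).
have H : deriv_at (fun y => \int[mu]_(t in `[a, y]) f t
                             - \int[mu]_(t in `[a, 0]) f t) x (f x).
  rewrite -[f x]subr0; apply: deriv_atB; last exact: deriv_at_cst.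
  by rewrite -Fx; exact: derivable_deriv_at.
apply: near_eq_is_derive H.
near=> y; have : `|x - y| < 3^-1 by near: y; exact: nbhsx_ballx.
move=> xy; have [xy1 xy2] := ltr_normlP _ _ xy; apply/esym/FE.
- by rewrite /a; have := normr_ge0 x; lra.
- by rewrite /a; lra.
- by rewrite /a; have := lerB_dist x y; lra.
Unshelve. all: end_near. Qed.

Lemma Rintegral_shift g a b c : continuous g -> a <= b ->
  \int[mu]_(x in `[a, b]) g (c + x) = \int[mu]_(x in `[c + a, c + b]) g x.
Proof.
move=> cg ab; have [G dG] := continuous_primitive cg.
rewrite (@FTC_Rintegral g G)// ?lerD2l//.
rewrite (@FTC_Rintegral _ (fun x => G (x + c)))//.
- by rewrite ![_ + c]addrC.
- by move=> x; rewrite addrC; exact: deriv_at_shift.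
- by move=> x; apply: continuous_comp; [apply: cvgD; [exact: cvg_cst|exact: cvg_id]|exact: cg].
Qed.

Lemma Rintegral_reflect g a b c : continuous g -> a <= b ->
  \int[mu]_(x in `[a, b]) g (c - x) = \int[mu]_(x in `[c - b, c - a]) g x.
Proof.
move=> cg ab; have [G dG] := continuous_primitive cg.
rewrite (@FTC_Rintegral g G)// ?lerD2l ?lerN2//.
rewrite (@FTC_Rintegral _ (fun x => - G (c - x)))//.
- by rewrite opprK addrC.
- move=> x; rewrite -[g _]opprK; apply: deriv_atN; exact: deriv_at_reflect.
- by move=> x; apply: continuous_comp; [apply: cvgB; [exact: cvg_cst|exact: cvg_id]|exact: cg].
Qed.

(** As a function of c the integral has derivative g(c + pi) - g(c - pi) = 0, so it equals its value
    at c = 0. *)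
Lemma periodic_integral g c : continuous g -> periodic g (pi *+ 2) ->
  \int[mu]_(x in `[c - pi, c + pi]) g x = torus_int g.
Proof.
move=> cg pg; have [G dG] := continuous_primitive cg.
have p0 := @pi_ge0 R.
rewrite /torus_int /torus (@FTC_Rintegral g G)//; last by lra.
rewrite (@FTC_Rintegral g G)//; last by lra.
have := @is_derive_0_is_cst R (fun c => G (c + pi) - G (c + - pi)) c 0.
rewrite !add0r; apply => x.
rewrite -(subrr (g (x + pi))).
have gE : g (x - pi) = g (x + pi).
  by rewrite -(pg (x - pi)) mulr2n addrA subrK.
by rewrite -{2}gE; apply: deriv_atB; exact: deriv_at_shift.
Qed.

Lemma periodic_shift g c : continuous g -> periodic g (pi *+ 2) ->
  torus_int (fun s => g (c + s)) = torus_int g.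
Proof.
move=> cg pg; have p0 := @pi_ge0 R; rewrite /torus_int /torus Rintegral_shift//; last by lra.
exact: periodic_integral.
Qed.

Lemma periodic_reflect g c : continuous g -> periodic g (pi *+ 2) ->
  torus_int (fun s => g (c - s)) = torus_int g.
Proof.
move=> cg pg; have p0 := @pi_ge0 R; rewrite /torus_int /torus Rintegral_reflect//; last by lra.
by rewrite opprK; exact: periodic_integral.
Qed.

Lemma Rintegral_itv_cst a b c : a <= b ->
  \int[mu]_(_ in `[a, b]) c = c * (b - a).
Proof.
move=> ab; rewrite Rintegral_cst//= lebesgue_measure_itv/= lte_fin.
move: ab; rewrite le_eqVlt => /predU1P[->|->//].
by rewrite ltxx subrr.
Qed.

Lemma Rintegral_norm_le f a b K : a <= b ->
  mu.-integrable `[a, b] (EFin \o f) ->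
  (forall x, a <= x <= b -> `|f x| <= K) ->
  `|\int[mu]_(x in `[a, b]) f x| <= K * (b - a).
Proof.
move=> ab fi fK; rewrite -Rintegral_itv_cst//.
apply: le_trans (le_normr_Rintegral _ fi) _ => //; apply: le_Rintegral => //.
- exact: (integrable_norm fi).
- apply: continuous_integrable => x; exact: cvg_cst.
Qed.

Lemma bounded_integrable f a b K : measurable_fun `[a, b] f ->
  (forall x, a <= x <= b -> `|f x| <= K) ->
  mu.-integrable `[a, b] (EFin \o f).
Proof.
move=> mf fK; apply: measurable_bounded_integrable => //.
  by rewrite /= lebesgue_measure_itv/=; case: ifP => // _; rewrite ltry.
exists K; split; first exact: num_real.
move=> M KM x /=; rewrite in_itv/= => xab.
exact: le_trans (fK _ xab) (ltW KM).
Qed.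

(** Inversion is not continuous at 0, where it takes the default value 0; measurability survives
    because that point is split off. *)
Lemma measurable_inv : measurable_fun setT (@GRing.inv R).
Proof.
have -> : setT = [set x : R | x != 0] `|` [set 0].
  by apply/seteqP; split=> // x _ /=; have [->|] := eqVneq x 0; [right|left].
apply/measurable_funU => //.
  apply: open_measurable; exact: open_neq.
split.
  apply: open_continuous_measurable_fun; first exact: open_neq.
  by move=> x; rewrite inE/= => x0; exact: inv_continuous.
exact: measurable_fun_set1.
Qed.

Lemma torus_int_le (g : R -> R) (K : R) : continuous g ->
  (forall x, `|g x| <= K) -> `|torus_int g| <= 2 * pi * K.
Proof.
move=> cg gK; have p0 := @pi_gt0 R.
rewrite /torus_int /torus; apply: le_trans (Rintegral_norm_le _ _ _) _.
- lra.
- exact: continuous_integrable.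
- by move=> x _; exact: gK.
- lra.
Qed.

Lemma torus_intB (f g : R -> R) : continuous f -> continuous g ->
  torus_int (fun x => f x - g x) = torus_int f - torus_int g.
Proof.
by move=> cf cg; rewrite /torus_int /torus RintegralB//; exact: continuous_integrable.
Qed.

Lemma torus_intD f g : continuous f -> continuous g ->
  torus_int (fun x => f x + g x) = torus_int f + torus_int g.
Proof.
by move=> cf cg; rewrite /torus_int /torus RintegralD//; exact: continuous_integrable.
Qed.

Lemma torus_intZ c f : continuous f -> torus_int (fun x => c * f x) = c * torus_int f.
Proof.
by move=> cf; rewrite /torus_int /torus RintegralZl//; exact: continuous_integrable.
Qed.

Lemma torus_int_cst (c : R) : torus_int (fun _ => c) = 2 * pi * c.
Proof.
have p0 := @pi_gt0 R.
by rewrite /torus_int /torus Rintegral_itv_cst; [ring|lra].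
Qed.

Lemma le_torus_int (f g : R -> R) : continuous f -> continuous g ->
  (forall x, f x <= g x) -> torus_int f <= torus_int g.
Proof.
move=> cf cg fg; apply: le_Rintegral.
- exact: measurable_torus.
- exact: (continuous_integrable (- pi) pi cf).
- exact: (continuous_integrable (- pi) pi cg).
- by move=> x _; exact: fg.
Qed.

End Integration.

(** * Principal values of bounded integrands *)

Section PrincipalValue.
Context {R : realType}.
Notation mu := (@lebesgue_measure R).

(** The excised interval contributes at most 2 K e. Only measurability is assumed, because the
    singular integrand is a quotient 0 / 0 at its centre and need not be continuous there. *)
Lemma pv_bounded (c : R) (g : R -> R) (K : R) :
  measurable_fun `[- pi, pi] (fun s => g (c + s)) ->
  (forall s, - pi <= s <= pi -> `|g (c + s)| <= K) ->
  pv c g = torus_int (fun s => g (c + s)).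
Proof.
move=> mg gK; have p0 := @pi_gt0 R.
have gi := bounded_integrable mg gK.
have K0 : 0 <= K by apply: le_trans (gK 0 _) => //; lra.
have A_ e : 0 < e -> e < pi -> (`[- pi, pi]%classic : set R) =
   [set s | e < `|s| <= pi] `|` `[- e, e]%classic.
  move=> e0 ep; apply/seteqP; split=> [s|s] /=; rewrite !in_itv/= -!ler_norml.
    by move=> ->; rewrite andbT; case: (ltP e `|s|); [left|right].
  by case=> [/andP[]//|/le_trans->//]; exact: ltW.
apply: cvg_lim; first exact: Rhausdorff.
apply/cvgrPdist_le => eps eps0; near=> e.
have e0 : 0 < e by near: e; exact: nbhs_right_gt.
have ep : e < pi by near: e; exact: nbhs_right_lt.
have mA : measurable [set s : R | e < `|s| <= pi].
  rewrite (_ : mkset _ = `[- pi, pi]%classic `&` ~` `[- e, e]%classic).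
    by apply: measurableI => //; exact: measurableC.
  apply/seteqP; split=> s /=; rewrite !in_itv/= -!ler_norml.
    by move=> /andP[es sp]; split=> //; apply/negP; rewrite -ltNge.
  by case=> -> /negP; rewrite -ltNge => ->.
rewrite /torus_int /torus (A_ _ e0 ep) Rintegral_setU//; last 2 first.
- by rewrite -(A_ _ e0 ep).
- apply/disj_setPS => s /= []; rewrite in_itv/= -ler_norml => /andP[es _].
  by rewrite leNgt es.
rewrite [X in X - _]addrC addrK.
have gi' : mu.-integrable `[- e, e] (EFin \o (fun s => g (c + s))).
  apply: integrableS gi => //; apply: subset_itv; rewrite bnd_simp; lra.
apply: le_trans (Rintegral_norm_le _ gi' (K := K) _) _.
- lra.
- by move=> x xe; apply: gK; lra.
have : e <= eps / (2 * (K + 1)).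
  by near: e; apply: nbhs_right_le; rewrite divr_gt0// mulr_gt0//; lra.
rewrite ler_pdivlMr; last by lra.
nra.
Unshelve. all: end_near. Qed.

End PrincipalValue.

Section Periodic.
Context {R : realType}.

Lemma periodic_repr (f : R -> R) (x : R) : periodic f (pi *+ 2) ->
  exists2 y, - pi <= y <= pi & f y = f x.
Proof.
move=> pf; have p0 := @pi_gt0 R; set T := pi *+ 2 in pf.
have T0 : 0 < T by rewrite /T mulr2n; lra.
pose k := Num.floor ((x + pi) / T).
have [k1 k2] : k%:~R * T <= x + pi /\ x + pi < k%:~R * T + T.
  rewrite -ler_pdivlMr// ge_floor; split=> //.
  have := floorD1_gt ((x + pi) / T); rewrite intrD ltr_pdivrMr// mulrDl mul1r.
  by [].
exists (x - k%:~R * T).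
  have TE : T = pi + pi by rewrite /T mulr2n.
  by move: k1 k2; move: (k%:~R * T) => w; lra.
have pn n a : f (a + T *+ n) = f a by exact: periodicn.
case: (k) => n.
  have -> : (Posz n)%:~R = n%:R :> R by [].
  by rewrite -(pn n) -[T *+ n]mulr_natl subrK.
have -> : (Negz n)%:~R = - n.+1%:R :> R by rewrite NegzE mulrNz.
by rewrite mulNr opprK mulr_natl pn.
Qed.

Lemma derive1_periodic (f df : R -> R) T : periodic f T ->
  (forall x, deriv_at f x (df x)) -> periodic df T.
Proof.
move=> pf dff x; rewrite -(derive1_deriv_at (dff x)).
have /derive1_deriv_at <- : deriv_at (fun y => f (y + T)) x (df (x + T)).
  exact: deriv_at_shift.
by congr derive1; apply/funext => y; rewrite pf.
Qed.

Lemma periodic_max (f : R -> R) : continuous f -> periodic f (pi *+ 2) ->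
  exists2 y, - pi <= y <= pi & forall x, f x <= f y.
Proof.
move=> cf pf; have p0 := @pi_gt0 R.
have [||y] := @EVT_max R f (- pi) pi; [lra|exact: continuous_subspaceT|].
rewrite in_itv/= => yp ymax; exists y => // x.
by have [z zp <-] := periodic_repr x pf; apply: ymax; rewrite in_itv.
Qed.

Lemma periodic_bounded (f : R -> R) : continuous f -> periodic f (pi *+ 2) ->
  exists2 K, 0 <= K & forall x, `|f x| <= K.
Proof.
move=> cf pf; have [||y _ ymax] := @periodic_max (fun x => `|f x|).
- by move=> x; apply: continuous_comp; [exact: cf|exact: norm_continuous].
- by move=> x; rewrite pf.
by exists `|f y|.
Qed.

End Periodic.

(** * The essential supremum of a continuous function *)

Section TorusNorm.
Context {R : realType}.
Implicit Types g : R -> R.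

Lemma torus_measure_gt0 : (0 < torus_measure R setT)%E.
Proof.
have p0 := @pi_gt0 R; have pp : - pi < pi :> R by lra.
rewrite /torus_measure/= /mrestr setTI /torus lebesgue_measure_itv/=.
by rewrite lte_fin pp -EFinB lte_fin subr_gt0.
Qed.

Lemma normLoo_ge0 g : 0 <= normLoo g.
Proof. by rewrite fine_ge0// Lnorm_ge0. Qed.

Lemma ess_sup_le_bound g B : (forall x, `|g x| <= B) ->
  ('N[torus_measure R]_+oo[EFin \o g] <= B%:E)%E.
Proof.
move=> gB; rewrite unlock torus_measure_gt0; apply/ess_supP.
by apply: aeW => x /=; rewrite lee_fin.
Qed.

Lemma normLoo_le g B : (forall x, `|g x| <= B) -> normLoo g <= B.
Proof.
move=> gB; have NB := ess_sup_le_bound gB.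
rewrite -lee_fin /normLoo /torus_norm fineK//.
by rewrite ge0_fin_numE ?Lnorm_ge0// (le_lt_trans NB)// ltry.
Qed.

(** A value above the essential supremum would persist, by continuity, on an interval of positive
    measure. *)
Lemma normLoo_ge g x : continuous g -> periodic g (pi *+ 2) -> `|g x| <= normLoo g.
Proof.
move=> cg pg; have p0 := @pi_gt0 R; have [K K0 gK] := periodic_bounded cg pg.
have [y yp <-] := periodic_repr x pg.
rewrite leNgt; apply/negP => Ny.
have NE : (normLoo g)%:E = 'N[torus_measure R]_+oo[EFin \o g]%E.
  rewrite /normLoo /torus_norm fineK//.
  by rewrite ge0_fin_numE ?Lnorm_ge0// (le_lt_trans (ess_sup_le_bound gK))// ltry.
have /ess_supP : (ess_sup (torus_measure R) (abse \o (EFin \o g)) <= (normLoo g)%:E)%E.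
  by rewrite NE unlock torus_measure_gt0.
move=> [A [mA A0 sA]].
have [d d0 dP] : exists2 d, 0 < d & forall z, `|y - z| < d -> normLoo g < `|g z|.
  have cy : {for y, continuous (fun z => `|g z|)}.
    by apply: continuous_comp; [exact: cg|exact: norm_continuous].
  have /nbhs_ballP[d d0 dP] := cy _ (lt_nbhsr Ny).
  by exists d => // z yz; apply: dP.
have [a [b [ab ap bp yab]]] : exists a b, [/\ a < b, - pi <= a, b <= pi &
    forall z, a <= z <= b -> `|y - z| < d].
  (* The interval is taken on the side of y facing 0, so that it stays inside the torus even when y
     is an end point. *)
  pose e := Num.min (d / 2) pi.
  have e0 : 0 < e by rewrite lt_min divr_gt0.
  have e1 : e <= d / 2 by rewrite ge_min lexx.
  have e2 : e <= pi by rewrite ge_min lexx orbT.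
  have [y0|y0] := leP 0 y.
    by exists (y - e), y; split; [lra|lra|lra|move=> z zb; rewrite ltr_norml; lra].
  by exists y, (y + e); split; [lra|lra|lra|move=> z zb; rewrite ltr_norml; lra].
have : (torus_measure R `[a, b]%classic <= 0)%E.
  rewrite -A0; apply: le_measure; rewrite ?inE//.
  move=> z /=; rewrite in_itv/= => zab; apply: sA => /=.
  by apply/negP; rewrite -ltNge lte_fin dP// yab.
rewrite /torus_measure/= /mrestr setIidl.
  rewrite lebesgue_measure_itv/= lte_fin ab leNgt lte_fin => /negP; apply.
  by rewrite subr_gt0.
apply: subset_itv; rewrite bnd_simp//.
Qed.

End TorusNorm.

(** * The singular integral *)

Section SingularKernel.
Context {R : realType}.

(* Lower bound for 2 sin(b/2)^2 times the kernel produced by the integration by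
   parts when all slopes are at most Z: the first correction comes from
   (1 - q) / (1 + q)^2 >= 1 - 3 q, the second one from slopes at most Z, Z and
   2 Z multiplying sinh. *)
Definition damping (Z : R) : R :=
  1 - 3 * sinh (pi * Z / 2) ^+ 2 - 3 * Z * sinh (pi * Z).

(** In half-angle variables s2 = sin^2 (b / 2) and r = sinh^2 (d' / 2) one has cosh d' - cos b = 2
    (s2 + r) and 1 - cos b cosh d' = 2 (s2 - r) + 4 s2 r, of which the last, nonnegative, term is
    dropped. *)
Lemma kernel_main (s2 r q2 : R) : 0 < s2 -> 0 <= r -> r <= q2 * s2 ->
  3 * q2 <= 1 ->
  (1 - 3 * q2) / (2 * s2) <= (2 * (s2 - r)) / (2 * (s2 + r)) ^+ 2.
Proof.
move=> s0 r0 rq q1; have sr : 0 < s2 + r by lra.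
rewrite ler_pdivlMr ?exprn_gt0 ?mulr_gt0// mulrAC ler_pdivrMr ?mulr_gt0//.
have H : (1 - 3 * q2) * s2 <= s2 - 3 * r by lra.
suff H2 : ((1 - 3 * q2) * s2) * (s2 + r) ^+ 2 <= (s2 - r) * s2 ^+ 2.
  have : s2 * ((1 - 3 * q2) * (s2 + r) ^+ 2) <= s2 * ((s2 - r) * s2).
    by move: H2; rewrite expr2; lra.
  by rewrite ler_pM2l// => {}H; lra.
apply: (le_trans (y := (s2 - 3 * r) * (s2 + r) ^+ 2)).
  by rewrite ler_wpM2r ?sqr_ge0.
have : 0 <= r * r * (5 * s2 + 3 * r) by rewrite !mulr_ge0//; lra.
lra.
Qed.

Lemma norm_mul3_le (a b c A B C : R) : `|a| <= A -> `|b| <= B -> `|c| <= C ->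
  `|a * b * c| <= A * B * C.
Proof. by move=> *; rewrite !normrM !ler_pM ?mulr_ge0. Qed.

(* The left-hand side is the integrand of the difference of the singular integrals
   at x + h and x after integration by parts: d and d' are the increments of f
   over [x - b, x] and [x + h - b, x + h], v and v' the slopes at their left end
   points, p the common slope at x and x + h. *)
Lemma kernel_upper (Z b d d' v v' p G : R) :
  0 < `|b| <= pi -> 0 <= Z -> 0 <= damping Z ->
  `|d| <= Z * `|b| -> `|d'| <= Z * `|b| -> `|v'| <= Z -> `|p - v| <= 2 * Z ->
  0 <= G -> d' - d = G ->
  G * ((cos b * cosh d' - 1 - sin b * sinh d' * v') / (cosh d' - cos b) ^+ 2)
  + sin b * (p - v) * ((cosh d' - cos b)^-1 - (cosh d - cos b)^-1)
  <= - (damping Z / 2) * G.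
Proof.
move=> /andP[b0 bp] Z0 th0 dZ d'Z v'Z pvZ G0 dG.
pose s := `|sin (b / 2)|; pose S := sinh (pi * Z).
pose q := sinh (pi * Z / 2).
have p0 := @pi_gt0 R.
have bs : `|b| <= pi * s := jordan bp.
have s0 : 0 < s.
  by rewrite -(pmulr_rgt0 _ p0); exact: lt_le_trans bs.
have s1 : s <= 1 := sin_max _.
have s2E : sin (b / 2) ^+ 2 = s ^+ 2 by rewrite real_normK ?num_real.
have pZ0 : 0 <= pi * Z by rewrite mulr_ge0// ltW.
have S0 : 0 <= S by exact: sinh_ge0.
have q0 : 0 <= q by apply: sinh_ge0; rewrite divr_ge0.
have qE : q = sinh (pi * Z / 2) by [].
have SE : S = sinh (pi * Z) by [].
have thE : damping Z = 1 - 3 * q ^+ 2 - 3 * Z * S by rewrite qE SE.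
clearbody q S; have ZS0 : 0 <= Z * S by exact: mulr_ge0.
have Zbs : Z * `|b| <= s * (pi * Z).
  by have := ler_wpM2l Z0 bs; lra.
have sm : sinh (Z * `|b|) <= s * S.
  by rewrite SE; apply: le_trans (sinh_homo Zbs) _; apply: sinh_scale => //; exact: ltW.
have q1 : 3 * q ^+ 2 <= 1 by move: th0; rewrite thE; lra.
have qS : `|sinh (d' / 2)| <= s * q.
  have H : `|d' / 2| <= s * (pi * Z / 2).
    rewrite normrM [`|2^-1|]gtr0_norm//; lra.
  rewrite qE; apply: le_trans (sinh_norm_le H) _.
  by apply: sinh_scale; rewrite ?divr_ge0//; exact: ltW.
pose r := sinh (d' / 2) ^+ 2.
have r0 : 0 <= r by exact: sqr_ge0.
have rq : r <= q ^+ 2 * s ^+ 2.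
  rewrite /r [q ^+ 2 * _]mulrC -exprMn -(real_normK (num_real (sinh (d' / 2)))).
  by apply: lerXn2r; rewrite ?nnegrE ?mulr_ge0 ?(ltW s0).
have D'E : cosh d' - cos b = 2 * (s ^+ 2 + r).
  by rewrite cosh_half cos_half s2E /r; ring.
have D0 : 2 * s ^+ 2 <= cosh d - cos b.
  by rewrite cos_half s2E; have := cosh_ge1 d; lra.
have ss0 : 0 < s ^+ 2 by exact: exprn_gt0.
have ss1 : s ^+ 2 <= 1 by rewrite exprn_ile1// ltW.
have D'0 : 2 * s ^+ 2 <= cosh d' - cos b by rewrite D'E; lra.
have D'p : 0 < cosh d' - cos b by lra.
have Dp : 0 < cosh d - cos b by lra.
have sinb : `|sin b| <= 2 * s.
  rewrite sin_half !normrM -/s [`|2|]gtr0_norm// ler_piMr ?mulr_ge0 ?(ltW s0)//.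
  exact: cos_max.
(* [A] is the dissipative part, of order - s^-2; [B] and [C] are errors of the same order whose
   coefficients are small with Z. *)
have A : (cos b * cosh d' - 1) / (cosh d' - cos b) ^+ 2
         <= - ((1 - 3 * q ^+ 2) / (2 * s ^+ 2)).
  rewrite lerNr -[leRHS]mulNr; apply: le_trans (kernel_main ss0 r0 rq q1) _.
  rewrite D'E ler_pM2r ?invr_gt0 ?exprn_gt0 ?mulr_gt0//; last by lra.
  rewrite cosh_half cos_half s2E -/r.
  have : 0 <= s ^+ 2 * r by rewrite mulr_ge0// ltW.
  lra.
have den4 : 4 * s ^+ 2 * s ^+ 2 <= (cosh d' - cos b) ^+ 2 by nra.
have B : - (sin b * sinh d' * v') / (cosh d' - cos b) ^+ 2
         <= Z * S / (2 * s ^+ 2).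
  apply: le_trans (ler_norm _) _.
  rewrite normrM normrN [`|(_ ^+ 2)^-1|]gtr0_norm ?invr_gt0 ?exprn_gt0//.
  rewrite ler_pdivrMr ?exprn_gt0//.
  have num : `|sin b * sinh d' * v'| <= 2 * s * (s * S) * Z.
    by apply: norm_mul3_le => //; exact: le_trans (sinh_norm_le d'Z) sm.
  apply: le_trans num _; rewrite [leRHS]mulrAC ler_pdivlMr ?mulr_gt0//.
  by have := ler_wpM2l ZS0 den4; lra.
(* The difference of the reciprocals is proportional to cosh d - cosh d', hence to G: this term too
   is a multiple of G and can be absorbed by [A]. *)
have C : sin b * (p - v) * ((cosh d' - cos b)^-1 - (cosh d - cos b)^-1)
         <= G * (2 * (Z * S) / (2 * s ^+ 2)).
  have -> : (cosh d' - cos b)^-1 - (cosh d - cos b)^-1 =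
            (cosh d - cosh d') / ((cosh d' - cos b) * (cosh d - cos b)).
    by field; rewrite !gt_eqF.
  apply: le_trans (ler_norm _) _; rewrite mulrA normrM normfV.
  rewrite [`|(cosh d' - _) * _|]gtr0_norm ?mulr_gt0// ler_pdivrMr ?mulr_gt0//.
  have ch : `|cosh d - cosh d'| <= s * S * G.
    apply: le_trans (cosh_diff_le dZ d'Z) _.
    rewrite (_ : `|d - d'| = G); first exact: (ler_wpM2r G0 sm).
    by rewrite distrC dG ger0_norm.
  have num : `|sin b * (p - v) * (cosh d - cosh d')|
             <= 2 * s * (2 * Z) * (s * S * G).
    exact: norm_mul3_le.
  apply: le_trans num _; rewrite [X in _ <= X * _]mulrA [leRHS]mulrAC ler_pdivlMr ?mulr_gt0//.
  have dd : 4 * s ^+ 2 * s ^+ 2 <= (cosh d' - cos b) * (cosh d - cos b) by nra.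
  have := ler_wpM2l (mulr_ge0 ZS0 G0) dd; lra.
(* As s <= 1, the singular weight s^-2 is at least 1. Bounding it by 1 leaves a multiple of G whose
   integral is explicit. *)
have th2 : damping Z <= damping Z / s ^+ 2.
  by rewrite ler_pdivlMr// ler_piMr.
rewrite mulrBl -mulNr.
have := ler_wpM2l G0 (lerD A B) => AB.
have := lerD AB C.
have -> : G * (- ((1 - 3 * q ^+ 2) / (2 * s ^+ 2)) + Z * S / (2 * s ^+ 2))
   + G * (2 * (Z * S) / (2 * s ^+ 2)) = - (damping Z / s ^+ 2 / 2) * G.
  by rewrite thE; field; rewrite gt_eqF.
move=> H; apply: (le_trans H); rewrite !mulNr lerN2 ler_wpM2r// ler_pM2r//.
Qed.

End SingularKernel.

(** * Integration by parts in the singular term *)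

Section SingularTerm.
Context {R : realType}.
Variables (u du : R -> R) (Z Lam : R).
Hypothesis uE : forall x, deriv_at u x (du x).
Hypothesis u_per : periodic u (pi *+ 2).
Hypothesis du_cont : continuous du.
Hypothesis duZ : forall x, `|du x| <= Z.
Hypothesis du_lip : forall x y, `|du x - du y| <= Lam * `|x - y|.
Notation mu := (@lebesgue_measure R).

Let u_cont : continuous u.
Proof. by move=> x; exact: deriv_at_continuous (uE x). Qed.

Let Z0 : 0 <= Z. Proof. exact: le_trans (duZ 0). Qed.

Let Lam0 : 0 <= Lam.
Proof. by have := le_trans (normr_ge0 _) (du_lip 1 0); rewrite subr0 normr1 mulr1. Qed.

(* The gap vanishes at b = 0, where the integrand below takes the value 0. *)
Definition gap (y b : R) : R := cosh (u y - u (y - b)) - cos b.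

Definition singular_integrand (y b : R) : R :=
  sin b * (du y - du (y - b)) / gap y b.

Let gap_ge (y b : R) : `|b| <= pi -> 2 * `|b| ^+ 2 <= pi ^+ 2 * gap y b.
Proof.
move=> bp; rewrite /gap cos_half; have := cosh_ge1 (u y - u (y - b)).
have := jordan bp; rewrite -[sin (b / 2) ^+ 2]real_normK ?num_real//.
move: (cosh _) => C; move: `|sin _| => s H C1.
have p0 := @pi_gt0 R.
have : `|b| ^+ 2 <= (pi * s) ^+ 2.
  by rewrite lerXn2r ?nnegrE// (le_trans _ H).
have : 0 <= pi ^+ 2 * (C - 1) by rewrite mulr_ge0 ?sqr_ge0//; lra.
lra.
Qed.

Let gap_gt0 (y b : R) : 0 < `|b| <= pi -> 0 < gap y b.
Proof.
move=> /andP[b0 bp]; have p0 : 0 < pi ^+ 2 :> R by rewrite exprn_gt0 ?pi_gt0.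
rewrite -(pmulr_rgt0 _ p0); apply: lt_le_trans (gap_ge y bp).
by rewrite mulr_gt0// exprn_gt0.
Qed.

Let div_gap_le (y b a K : R) : `|b| <= pi -> 0 <= K -> `|a| <= K * `|b| ^+ 2 ->
  `|a / gap y b| <= K * pi ^+ 2.
Proof.
move=> bp K0 aK; have p0 : 0 < pi ^+ 2 :> R by rewrite exprn_gt0 ?pi_gt0.
have [b0|bn0] := eqVneq b 0.
  have -> : a = 0.
    apply/eqP; rewrite -normr_le0; apply: le_trans aK _.
    by rewrite b0 normr0 expr0n mulr0.
  by rewrite mul0r normr0 mulr_ge0// ltW.
have bb : 0 < `|b| <= pi by rewrite normr_gt0 bn0.
have g0 := gap_gt0 y bb.
rewrite normrM normfV (gtr0_norm g0) ler_pdivrMr//; apply: le_trans aK _.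
have := gap_ge y bp; have : 0 <= `|b| ^+ 2 by rewrite sqr_ge0.
move: (`|b| ^+ 2) (gap y b) => B g B0 H.
by have := ler_wpM2l K0 H; have := mulr_ge0 K0 B0; lra.
Qed.

Let integrand_le (y b : R) : `|b| <= pi ->
  `|singular_integrand y b| <= Lam * pi ^+ 2.
Proof.
move=> bp; apply: div_gap_le => //.
rewrite normrM expr2 mulrCA ler_pM//; first exact: sin_norm_le.
by have := du_lip y (y - b); rewrite subKr.
Qed.

Let gap_cont (y b : R) : {for b, continuous (gap y)}.
Proof.
apply: continuous_atB; last exact: continuous_cos.
apply: continuous_at_comp; first exact: continuous_cosh.
by apply: continuous_atB; [exact: continuous_at_cst|exact: continuous_at_reflect].
Qed.

Let num_cont (y b : R) : {for b, continuous (fun b => sin b * (du y - du (y - b)))}.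
Proof.
apply: continuous_atM; first exact: continuous_sin.
by apply: continuous_atB; [exact: continuous_at_cst|exact: continuous_at_reflect].
Qed.

Let integrand_cont (y b : R) : 0 < `|b| <= pi ->
  {for b, continuous (singular_integrand y)}.
Proof.
move=> bp; apply: continuous_atM; first exact: num_cont.
by apply: continuous_atV; [rewrite gt_eqF// gap_gt0|exact: gap_cont].
Qed.

Let integrand_meas (y a b : R) : measurable_fun `[a, b] (singular_integrand y).
Proof.
apply: (@measurable_funS _ _ _ _ setT) => //.
apply: measurable_funM; first by apply: continuous_measurable_fun => ?; exact: num_cont.
apply: (measurableT_comp measurable_inv).
by apply: continuous_measurable_fun => ?; exact: gap_cont.
Qed.

Let integrand_integrable (y a b : R) : - pi <= a -> b <= pi ->
  mu.-integrable `[a, b] (EFin \o singular_integrand y).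
Proof.
move=> ap bp; apply: (bounded_integrable (@integrand_meas y a b)) => s sab.
by apply: integrand_le; rewrite ler_norml; lra.
Qed.

Lemma pv_singular y : pv 0 (singular_integrand y) = torus_int (singular_integrand y).
Proof.
have E : (fun s => singular_integrand y (0 + s)) = singular_integrand y.
  by apply/funext => s; rewrite add0r.
rewrite (@pv_bounded R 0 (singular_integrand y) (Lam * pi ^+ 2)).
- exact: (congr1 (@torus_int R) E).
- by rewrite E; exact: integrand_meas.
- by move=> s sp; rewrite add0r; apply: integrand_le; rewrite ler_norml.
Qed.

Variables (x h : R).
Let w y := u (y + h) - u y.
Hypothesis x_max : forall y, w y <= w x.
Hypothesis damping0 : 0 <= damping Z.

Let dw y := du (y + h) - du y.

Let wE y : deriv_at w y (dw y).
Proof. by apply: deriv_atB => //; exact: deriv_at_shift. Qed.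

Let dwx : du (x + h) = du x.
Proof. by apply/subr0_eq; exact: deriv_at_max (wE x) x_max. Qed.

Let G b := w x - w (x - b).

Let GE b : deriv_at G b (dw (x - b)).
Proof.
have := deriv_atB (deriv_at_cst (w x) b) (deriv_at_reflect (wE (x - b))).
by rewrite sub0r opprK.
Qed.

Let G0 b : 0 <= G b. Proof. by rewrite subr_ge0. Qed.

(** The derivative of w vanishes at the maximum x and is Lipschitz, hence a quadratic bound. It
    matches the quadratic vanishing of the gap. *)
Let Gle b : `|G b| <= 2 * Lam * `|b| ^+ 2.
Proof.
have dwL y : `|dw y| <= 2 * Lam * `|x - y|.
  have -> : dw y = - (du (x + h) - du (y + h)) + (du x - du y).
    by rewrite /dw dwx; ring.
  apply: le_trans (ler_normD _ _) _; rewrite normrN.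
  have := du_lip (x + h) (y + h); have := du_lip x y.
  rewrite (_ : x + h - (y + h) = x - y); last by ring.
  lra.
have aux c : `|x - c| <= `|b| -> `|dw c * b| <= 2 * Lam * `|b| ^+ 2.
  move=> cb; rewrite normrM expr2 mulrA ler_wpM2r//.
  by apply: le_trans (dwL c) _; rewrite ler_wpM2l ?mulr_ge0.
have [b0|b0] := leP 0 b.
  have xb : x - b <= x by rewrite gerBl.
  have [c [c1 c2 e]] := mean_value wE xb.
  rewrite /G e subKr; apply: aux.
  by rewrite !ger0_norm; lra.
have xb : x <= x - b by rewrite lerBrDl gerDr ltW.
have [c [c1 c2 e]] := mean_value wE xb.
rewrite /G -normrN opprB e addrAC subrr add0r mulrN normrN; apply: aux.
by rewrite ler0_norm ?ltr0_norm; lra.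
Qed.

(** The boundary term of the integration by parts: of order b at the singularity by [Gle], and zero
    at b = pi and b = - pi because of the sine. *)
Let F b := G b * sin b / gap (x + h) b.

Let gapE y b : deriv_at (gap y) b (sinh (u y - u (y - b)) * du (y - b) + sin b).
Proof.
rewrite -[sin b]opprK; apply: deriv_atB; last exact: is_derive_cos.
apply: (deriv_at_comp (f := @cosh R) (g := fun b => u y - u (y - b))).
  exact: deriv_at_cosh.
have := deriv_atB (deriv_at_cst (u y) b) (deriv_at_reflect (uE (y - b))).
by rewrite sub0r opprK.
Qed.

Definition boundary_derive b := ((dw (x - b) * sin b + G b * cos b) * gap (x + h) b
  - G b * sin b * (sinh (u (x + h) - u (x + h - b)) * du (x + h - b) + sin b))
  / gap (x + h) b ^+ 2.

Let FE b : 0 < `|b| <= pi -> deriv_at F b (boundary_derive b).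
Proof.
move=> bp; have g0 : gap (x + h) b != 0 by rewrite gt_eqF// gap_gt0.
exact: (deriv_at_div g0 (deriv_atM (GE b) (is_derive_sin b)) (gapE (x + h) b)).
Qed.

Let dF_cont b : 0 < `|b| <= pi -> {for b, continuous boundary_derive}.
Proof.
move=> bp; have du_c y : {for b, continuous (fun b => du (y - b))}.
  exact: continuous_at_reflect.
have dw_c : {for b, continuous (fun b => dw (x - b))}.
  apply: continuous_atB => //.
  rewrite (_ : (fun b => _) = (fun b => du ((x + h) - b))) //.
  by apply/funext => z; congr du; ring.
have Gc : {for b, continuous G} by exact: deriv_at_continuous (GE b).
apply: continuous_atM; last first.
  apply: continuous_atV; first by rewrite expf_neq0// gt_eqF// gap_gt0.
  by apply: continuous_atM; exact: gap_cont.
apply: continuous_atB; apply: continuous_atM.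
- apply: continuous_atD; apply: continuous_atM => //; first exact: continuous_sin.
  exact: continuous_cos.
- exact: gap_cont.
- by apply: continuous_atM => //; exact: continuous_sin.
- apply: continuous_atD; last exact: continuous_sin.
  apply: continuous_atM => //; apply: continuous_at_comp; first exact: continuous_sinh.
  by apply: continuous_atB; [exact: continuous_at_cst|exact: continuous_at_reflect].
Qed.

Let u_lip y b : `|u y - u (y - b)| <= Z * `|b|.
Proof.
by have := lipschitz_of_derive uE duZ (y - b) y; rewrite subKr.
Qed.

(** Since du (x + h) = du x, the difference of the two numerators over the gap at x + h is - sin b
    times the derivative of G. The product rule turns it into - F' plus G times the derivative of
    sin b / gap, and sin^2 + cos^2 = 1 brings that derivative to the form of [kernel_upper]. *)
Let pointwise b : 0 < `|b| <= pi ->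
  singular_integrand (x + h) b - singular_integrand x b <=
  - boundary_derive b - damping Z / 2 * G b.
Proof.
move=> bp; have g0 := gap_gt0 x bp; have gh0 := gap_gt0 (x + h) bp.
have dGE : (u (x + h) - u (x + h - b)) - (u x - u (x - b)) = G b.
  by rewrite /G /w (_ : x - b + h = x + h - b); ring.
have pv2 : `|du x - du (x - b)| <= 2 * Z.
  by apply: le_trans (ler_normB _ _) _; have := duZ x; have := duZ (x - b); lra.
have := kernel_upper bp Z0 damping0 (u_lip x b) (u_lip (x + h) b)
  (duZ (x + h - b)) pv2 (G0 b) dGE.
rewrite -lerBrDl; rewrite -/(gap x b) -/(gap (x + h) b).
suff -> : singular_integrand (x + h) b - singular_integrand x b =
   - boundary_derive b + (G b * ((cos b * cosh (u (x + h) - u (x + h - b)) - 1 -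
       sin b * sinh (u (x + h) - u (x + h - b)) * du (x + h - b)) / gap (x + h) b ^+ 2)
     + sin b * (du x - du (x - b)) * ((gap (x + h) b)^-1 - (gap x b)^-1)).
  rewrite lerBrDl => H; rewrite lerD2l; apply: le_trans H _.
  by rewrite mulNr.
have cE : cosh (u (x + h) - u (x + h - b)) = gap (x + h) b + cos b.
  by rewrite /gap subrK.
have s2 : sin b ^+ 2 = 1 - cos b ^+ 2 := sin2cos2 b.
have -> : - boundary_derive b = - (dw (x - b) * sin b + G b * cos b) / gap (x + h) b
  + (G b * sin b * sinh (u (x + h) - u (x + h - b)) * du (x + h - b)
     + G b * sin b ^+ 2) / gap (x + h) b ^+ 2.
  by rewrite /boundary_derive; field; rewrite gt_eqF.
rewrite /singular_integrand dwx cE s2 /dw (_ : x - b + h = x + h - b); last by ring.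
by field; rewrite !gt_eqF.
Qed.

Let G_cont : continuous G.
Proof. by move=> b; exact: deriv_at_continuous (GE b). Qed.

Let outer_piece (GP : R -> R) (a b : R) : (forall x, deriv_at GP x (G x)) ->
  a <= b -> (forall s, a <= s <= b -> 0 < `|s| <= pi) ->
  \int[mu]_(s in `[a, b])
     (singular_integrand (x + h) s - singular_integrand x s) <=
  F a - F b - damping Z / 2 * (GP b - GP a).
Proof.
move=> dGP ab sp; have p0 := @pi_gt0 R.
have ap : - pi <= a.
  have /andP[_ H] : 0 < `|a| <= pi by apply: sp; rewrite lexx ab.
  by move: H; rewrite ler_norml => /andP[].
have bp : b <= pi.
  have /andP[_ H] : 0 < `|b| <= pi by apply: sp; rewrite lexx ab.
  by move: H; rewrite ler_norml => /andP[].
pose m s := - boundary_derive s - damping Z / 2 * G s.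
have m_cont s : a <= s <= b -> {for s, continuous m}.
  move=> /sp sab; apply: continuous_atB.
    by apply: cvgN; exact: dF_cont.
  by apply: continuous_atM; [exact: continuous_at_cst|exact: G_cont].
have mi : mu.-integrable `[a, b] (EFin \o m).
  apply: continuous_compact_integrable; first exact: segment_compact.
  by apply: continuous_in_subspaceT => s; rewrite inE/= in_itv/=; exact: m_cont.
apply: (le_trans (y := \int[mu]_(s in `[a, b]) m s)).
  apply: le_Rintegral => //.
    rewrite (_ : EFin \o _ = (EFin \o singular_integrand (x + h)) \- (EFin \o singular_integrand x))%E //.
    by apply: integrableB => //; exact: integrand_integrable.
  by move=> s /=; rewrite in_itv/= => /sp; exact: pointwise.
have -> : \int[mu]_(s in `[a, b]) m s =
    - F b - damping Z / 2 * GP b - (- F a - damping Z / 2 * GP a).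
  apply: (@FTC_Rintegral_in _ m (fun s => - F s - damping Z / 2 * GP s) a b ab _ m_cont).
  move=> s /sp sab; apply: deriv_atB; first exact: (deriv_atN (FE sab)).
  by have := deriv_atM (deriv_at_cst (damping Z / 2) s) (dGP s); rewrite mul0r add0r.
by move: (F a) (F b) (damping Z / 2) => fa fb th; lra.
Qed.

Let F_le b : `|b| <= pi -> `|F b| <= 2 * Lam * `|b| * pi ^+ 2.
Proof.
move=> bp; apply: div_gap_le => //; first by rewrite !mulr_ge0.
rewrite normrM -mulrA [`|b| * _]mulrC mulrA ler_pM//; exact: sin_norm_le.
Qed.

Let int_G : torus_int G = 2 * pi * w x.
Proof.
have wc : continuous w by move=> y; exact: deriv_at_continuous (wE y).
have wp : periodic w (pi *+ 2).
  by move=> y; rewrite /w addrAC !u_per.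
have p0 := @pi_gt0 R; have pp : - pi <= pi :> R by lra.
have w0 : torus_int w = 0.
  rewrite /torus_int /torus RintegralB//; last 2 first.
  - apply: continuous_integrable => y.
    exact: deriv_at_continuous (deriv_at_shift (uE (y + h))).
  - exact: continuous_integrable.
  rewrite -[X in _ - X](@periodic_shift _ u h)//.
  by rewrite /torus_int; under eq_Rintegral do rewrite addrC; rewrite subrr.
rewrite /torus_int /torus RintegralB//; last 2 first.
- by apply: continuous_integrable => y; exact: continuous_at_cst.
- by apply: continuous_integrable => y; exact: continuous_at_reflect.
rewrite Rintegral_itv_cst// -[X in _ - X]/(torus_int (fun s => w (x - s))).
by rewrite periodic_reflect// w0; ring.
Qed.

Lemma singular_diff_le :
  pv 0 (singular_integrand (x + h)) - pv 0 (singular_integrand x) <=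
  - (pi * damping Z) * w x.
Proof.
have p0 := @pi_gt0 R; have pp : - pi <= pi :> R by lra.
rewrite !pv_singular.
have [GP dGP] := continuous_primitive G_cont.
have -> : - (pi * damping Z) * w x = - (damping Z / 2) * torus_int G.
  by rewrite int_G; field.
have -> : torus_int G = GP pi - GP (- pi).
  exact: FTC_Rintegral.
pose phi s := singular_integrand (x + h) s - singular_integrand x s.
have phi_i a b : - pi <= a -> b <= pi -> mu.-integrable `[a, b] (EFin \o phi).
  move=> ap bp.
  rewrite (_ : EFin \o phi = (EFin \o singular_integrand (x + h)) \- (EFin \o singular_integrand x))%E //.
  by apply: integrableB => //; exact: integrand_integrable.
have -> : torus_int (singular_integrand (x + h)) - torus_int (singular_integrand x)
          = \int[mu]_(s in `[- pi, pi]) phi s.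
  by rewrite /phi RintegralB//; exact: integrand_integrable.
pose L := Lam * pi ^+ 2; have L0 : 0 <= L by rewrite mulr_ge0// sqr_ge0.
(* The three errors of the excision of [- e, e]: the damping lost there (half of [damping Z] times 4
   L e), the two values of F at its ends, and the integral over it. *)
apply: (@le_of_addeps _ _ _ (2 * damping Z * L + 4 * L + 4 * L) pi) => //.
  by have := mulr_ge0 damping0 L0; lra.
move=> e e0 ep.
have i1 : mu.-integrable `[- pi, pi] (EFin \o phi) by exact: phi_i.
have i2 : mu.-integrable `[- e, pi] (EFin \o phi) by apply: phi_i => //; lra.
rewrite (@Rintegral_itv_split _ _ _ (- e))//; [|lra|lra].
rewrite (@Rintegral_itv_split _ _ (- e) e)//; [|lra|lra].
have A1 := @outer_piece GP (- pi) (- e) dGP.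
have A2 := @outer_piece GP e pi dGP.
have Fpi : F pi = 0 by rewrite /F sinpi mulr0 mul0r.
have FNpi : F (- pi) = 0 by rewrite /F sinN sinpi oppr0 mulr0 mul0r.
have mid : \int[mu]_(s in `[- e, e]) phi s <= 4 * L * e.
  apply: le_trans (ler_norm _) _.
  have i3 : mu.-integrable `[- e, e] (EFin \o phi) by apply: phi_i; lra.
  apply: le_trans (Rintegral_norm_le (K := 2 * L) _ i3 _) _; [lra| |lra].
  move=> s se; have sp : `|s| <= pi by rewrite ler_norml; lra.
  apply: le_trans (ler_normB _ _) _.
  by have := integrand_le (x + h) sp; have := integrand_le x sp; rewrite -/L; lra.
have Fe : F e <= 2 * L * e.
  apply: le_trans (ler_norm _) _; apply: le_trans (F_le _) _.
    by rewrite ger0_norm ltW.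
  by rewrite (gtr0_norm e0) /L; lra.
have FNe : - F (- e) <= 2 * L * e.
  apply: le_trans (ler_norm _) _; rewrite normrN; apply: le_trans (F_le _) _.
    by rewrite normrN ger0_norm ltW.
  by rewrite normrN (gtr0_norm e0) /L; lra.
have GPe : GP e - GP (- e) <= 4 * L * e.
  rewrite -(@FTC_Rintegral _ G)//; last by lra.
  apply: le_trans (ler_norm _) _.
  apply: le_trans (Rintegral_norm_le (K := 2 * L) _ _ _) _; [lra| | |lra].
    exact: continuous_integrable.
  move=> s se; apply: le_trans (Gle s) _; rewrite /L -mulrA ler_pM2l//.
  rewrite ler_wpM2l// lerXn2r ?nnegrE ?(ltW p0)// ler_norml; lra.
have := ler_wpM2l damping0 GPe.
have {}A1 : \int[mu]_(s in `[- pi, - e]) phi s <=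
    F (- pi) - F (- e) - damping Z / 2 * (GP (- e) - GP (- pi)).
  apply: A1; first by lra.
  by move=> s sp; rewrite normr_gt0 ler_norml lt_eqF; lra.
have {}A2 : \int[mu]_(s in `[e, pi]) phi s <=
    F e - F pi - damping Z / 2 * (GP pi - GP e).
  apply: A2; first by lra.
  by move=> s sp; rewrite normr_gt0 ler_norml gt_eqF; lra.
move: A1 A2 mid; rewrite Fpi FNpi; lra.
Qed.

End SingularTerm.

(** * The vorticity at the permeability jump *)

Section RegularTerm.
Context {R : realType}.
Notation mu := (@lebesgue_measure R).

Lemma pv_periodic (c : R) (g : R -> R) : continuous g -> periodic g (pi *+ 2) ->
  pv c g = torus_int g.
Proof.
move=> cg pg; have [K _ gK] := periodic_bounded cg pg.
rewrite (@pv_bounded _ c g K)//; first exact: periodic_shift.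
apply: (@measurable_funS _ _ _ _ setT) => //.
by apply: continuous_measurable_fun => y; exact: continuous_at_shift.
Qed.

(** As c runs through [-1, 1], S / (C - c) runs from S / (C + 1) to S / (C - 1). The midpoint of
    this range is C / S and its half-length is 1 / S. *)
Lemma poisson_sub_coth (C S c : R) : 0 < S -> C ^+ 2 - S ^+ 2 = 1 -> 1 < C ->
  -1 <= c -> c <= 1 -> `|S / (C - c) - C / S| <= S^-1.
Proof.
move=> S0 CS C1 c1 c2; have Cc : 0 < C - c by lra.
have -> : S / (C - c) - C / S = (S ^+ 2 - C ^+ 2 + C * c) / (S * (C - c)).
  by field; rewrite !gt_eqF.
rewrite normrM normfV [`|S * _|]gtr0_norm ?mulr_gt0// ler_pdivrMr ?mulr_gt0//.
rewrite mulrA mulVf ?gt_eqF// mul1r ler_norml; nra.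
Qed.

(* With a = C c - 1 and b = S s one has a^2 + b^2 = (C - c)^2, and the numerator is
   (1 - p p') a - (p + p') b, so that Cauchy-Schwarz applies. *)
Lemma poisson_derivative_le (C S c s p p' Z : R) : C ^+ 2 - S ^+ 2 = 1 ->
  c ^+ 2 + s ^+ 2 = 1 -> `|p| <= Z -> `|p'| <= Z -> 0 < C - c ->
  `|((p * C * p' + c) * (C - c) - (p * S + s) * (S * p' + s)) / (C - c) ^+ 2|
  <= (1 + Z ^+ 2) / (C - c).
Proof.
move=> CS cs pZ p'Z Cc; pose a := C * c - 1; pose b := S * s.
have SE : S ^+ 2 = C ^+ 2 - 1 by rewrite -CS; ring.
have sE : s ^+ 2 = 1 - c ^+ 2 by rewrite -cs; ring.
have abE : a ^+ 2 + b ^+ 2 = (C - c) ^+ 2.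
  by rewrite /a /b exprMn SE sE; ring.
have -> : (p * C * p' + c) * (C - c) - (p * S + s) * (S * p' + s) =
          (1 - p * p') * a - (p + p') * b.
  have -> : (p * C * p' + c) * (C - c) - (p * S + s) * (S * p' + s) =
    p * p' * (C ^+ 2 - S ^+ 2 - C * c) + c * C - (c ^+ 2 + s ^+ 2)
    - (p + p') * (S * s) by ring.
  by rewrite CS cs /a /b; ring.
rewrite normrM normfV [`|(C - c) ^+ 2|]gtr0_norm ?exprn_gt0//.
rewrite ler_pdivrMr ?exprn_gt0//.
have -> : (1 + Z ^+ 2) / (C - c) * (C - c) ^+ 2 = (1 + Z ^+ 2) * (C - c).
  by field; rewrite gt_eqF.
have Z0 : 0 <= Z := le_trans (normr_ge0 _) pZ.
have Z2 : 0 <= 1 + Z ^+ 2 by have := sqr_ge0 Z; lra.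
have sq (z : R) : `|z| <= Z -> 1 + z ^+ 2 <= 1 + Z ^+ 2.
  by move=> zZ; rewrite lerD2l -(real_normK (num_real z)) lerXn2r ?nnegrE.
have H : ((1 - p * p') * a - (p + p') * b) ^+ 2 <= ((1 + Z ^+ 2) * (C - c)) ^+ 2.
  apply: (le_trans (y := (1 + p ^+ 2) * (1 + p' ^+ 2) * (a ^+ 2 + b ^+ 2))).
    have := sqr_ge0 ((1 - p * p') * b + (p + p') * a); lra.
  rewrite abE exprMn ler_wpM2r ?sqr_ge0// [leRHS]expr2 ler_pM ?sq//.
    by have := sqr_ge0 p; lra.
  by have := sqr_ge0 p'; lra.
rewrite -(ler_pXn2r (n := 2))// ?nnegrE ?mulr_ge0 ?(ltW Cc)//.
by rewrite real_normK ?num_real.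
Qed.

Section Vorticity.
Variables (u : R -> R) (kp km rp rm h2 Z : R).
Let du := derive1 u.
Hypothesis uE : forall x, deriv_at u x (du x).
Hypothesis u_per : periodic u (pi *+ 2).
Hypothesis du_cont : continuous du.
Hypothesis duZ : forall x, `|du x| <= Z.
Hypothesis u_gt0 : forall x, 0 < u x.
Hypothesis h2_gt0 : 0 < h2.

Let u_cont : continuous u.
Proof. by move=> x; exact: deriv_at_continuous (uE x). Qed.

Let Z0 : 0 <= Z. Proof. exact: le_trans (duZ 0). Qed.

Let du_per : periodic du (pi *+ 2).
Proof. exact: derive1_periodic uE. Qed.

Let depth y := h2 + u y.

Let depthE y : deriv_at depth y (du y).
Proof. by have := deriv_atD (deriv_at_cst h2 y) (uE y); rewrite add0r. Qed.

Let depth_gt y : h2 <= depth y. Proof. by rewrite lerDl ltW. Qed.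

Let c0 : 0 < cosh h2 - 1. Proof. by rewrite subr_gt0 cosh_gt1. Qed.

Let denom_ge y t : cosh h2 - 1 <= cosh (depth y) - cos t.
Proof.
by rewrite lerB ?cos_le1// cosh_homo// ltW.
Qed.

Let denom_gt0 y t : 0 < cosh (depth y) - cos t.
Proof. exact: lt_le_trans (denom_ge y t). Qed.

Let cosh_depth_cont x : {for x, continuous (fun y => cosh (depth y))}.
Proof.
apply: continuous_at_comp; first exact: continuous_cosh.
exact: deriv_at_continuous (depthE x).
Qed.

Let sinh_depth_cont x : {for x, continuous (fun y => sinh (depth y))}.
Proof.
apply: continuous_at_comp; first exact: continuous_sinh.
exact: deriv_at_continuous (depthE x).
Qed.

Definition vorticity_integrand (b g : R) : R :=
  sinh (depth g) * du g / (cosh (depth g) - cos (b - g)).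

Let integrand_cont_at b g : {for g, continuous (vorticity_integrand b)}.
Proof.
apply: continuous_atM.
  by apply: continuous_atM; [exact: sinh_depth_cont|exact: du_cont].
apply: continuous_atV; first by rewrite gt_eqF.
apply: continuous_atB; first exact: cosh_depth_cont.
exact/continuous_at_reflect/continuous_cos.
Qed.

Let integrand_cont b : continuous (vorticity_integrand b).
Proof. by move=> g; exact: integrand_cont_at. Qed.

Let cos_shift (b g : R) : cos (b - (g + pi *+ 2)) = cos (b - g).
Proof.
by rewrite -[RHS]cosN -[RHS]cosD2pi -[LHS]cosN; congr cos; ring.
Qed.

Lemma varpi2E b :
  varpi2 kp km rp rm h2 u b = calA kp km rp rm * torus_int (vorticity_integrand b).
Proof.
congr (_ * _); apply: (@pv_periodic b (vorticity_integrand b)).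
  exact: integrand_cont.
by move=> g; rewrite /vorticity_integrand /depth u_per du_per cos_shift.
Qed.

Let coth_du g := du g * (cosh (depth g) / sinh (depth g)).

Let sinh_depth_gt0 g : 0 < sinh (depth g).
Proof. by apply: sinh_gt0; exact: lt_le_trans (depth_gt g). Qed.

Let coth_du_cont_at g : {for g, continuous coth_du}.
Proof.
apply: continuous_atM; first exact: du_cont.
apply: continuous_atM; first exact: cosh_depth_cont.
by apply: continuous_atV; [rewrite gt_eqF|exact: sinh_depth_cont].
Qed.

Let coth_du_cont : continuous coth_du.
Proof. by move=> g; exact: coth_du_cont_at. Qed.

Let int_coth_du : torus_int coth_du = 0.
Proof.
have p0 := @pi_gt0 R.
have dln g : deriv_at (fun g => ln (sinh (depth g))) g (coth_du g).
  have -> : coth_du g = (sinh (depth g))^-1 * (cosh (depth g) * du g).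
    by rewrite /coth_du; ring.
  have shE := deriv_at_comp (f := @sinh R) (deriv_at_sinh _) (depthE g).
  exact: (deriv_at_comp (f := @ln R) (g := fun g => sinh (depth g)) (is_derive1_ln (sinh_depth_gt0 g)) shE).
rewrite /torus_int /torus (FTC_Rintegral dln coth_du_cont); last by lra.
have upi : u pi = u (- pi) by rewrite -(u_per (- pi)) mulr2n addrA addNr add0r.
by rewrite /depth upi subrr.
Qed.

(* f' coth(h2 + f) is a derivative, so that it can be subtracted from the integrand:
   this gains a factor of order sinh(h2)^-1 for deep jumps. *)
Lemma varpi2_le b : `|varpi2 kp km rp rm h2 u b| <=
  `|calA kp km rp rm| * (2 * pi * (Z / sinh h2)).
Proof.
rewrite varpi2E normrM ler_wpM2l//.
rewrite -[torus_int _]subr0 -int_coth_du -torus_intB; [|exact: integrand_cont|exact: coth_du_cont].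
apply: torus_int_le.
  by move=> g; apply: continuous_atB; [exact: integrand_cont|exact: coth_du_cont].
move=> g; rewrite /vorticity_integrand /coth_du.
rewrite [sinh _ * _]mulrC -mulrA -mulrBr normrM ler_pM//.
apply: le_trans (poisson_sub_coth _ _ _ _ _) _; rewrite ?cos_geN1 ?cos_le1//.
- exact: cosh2B1.
- by apply: cosh_gt1; exact: lt_le_trans (depth_gt g).
- have H : sinh h2 <= sinh (depth g) by exact: sinh_homo.
  have s0 : 0 < sinh h2 by exact: sinh_gt0.
  by rewrite lef_pV2 ?posrE.
Qed.

(** Makes the integrand of the jump term continuous, so that its principal value is an ordinary
    integral. The kernel is Lipschitz in b because its denominator stays above cosh h2 - 1. *)
Lemma varpi2_continuous : continuous (varpi2 kp km rp rm h2 u).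
Proof.
have num_cont g : {for g, continuous (fun g => sinh (depth g) * du g)}.
  by apply: continuous_atM; [exact: sinh_depth_cont|exact: du_cont].
have [|K K0 gK] := periodic_bounded num_cont.
  by move=> g; rewrite /depth u_per du_per.
apply: (@lipschitz_continuous R _
  (`|calA kp km rp rm| * (2 * pi * (K / (cosh h2 - 1) ^+ 2)))) => a b.
rewrite !varpi2E -mulrBr normrM -[leRHS]mulrA ler_wpM2l//.
rewrite -torus_intB; [|exact: integrand_cont..].
rewrite -[leRHS]mulrA; apply: torus_int_le.
  by move=> g; apply: continuous_atB; exact: integrand_cont.
move=> g; rewrite /vorticity_integrand -mulrBr normrM -[leRHS]mulrA; apply: ler_pM => //.
have ga := denom_gt0 g (a - g); have gb := denom_gt0 g (b - g).
have -> : (cosh (depth g) - cos (a - g))^-1 - (cosh (depth g) - cos (b - g))^-1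
  = (cos (a - g) - cos (b - g)) /
    ((cosh (depth g) - cos (a - g)) * (cosh (depth g) - cos (b - g))).
  by field; rewrite !gt_eqF.
rewrite normrM mulrC ler_pM//.
  rewrite normfV gtr0_norm ?mulr_gt0// lef_pV2 ?posrE ?mulr_gt0 ?exprn_gt0//.
  by rewrite expr2 ler_pM// ltW.
have sin1 (x : R) : `|- sin x| <= 1 by rewrite normrN; exact: sin_max.
have := lipschitz_of_derive (@is_derive_cos R) sin1 (b - g) (a - g).
by rewrite mul1r (_ : a - g - (b - g) = a - b)//; ring.
Qed.

Lemma varpi2_periodic : periodic (varpi2 kp km rp rm h2 u) (pi *+ 2).
Proof.
move=> b; rewrite !varpi2E; congr (_ * torus_int _); apply/funext => g.
rewrite /vorticity_integrand; congr (_ / (_ - _)).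
by rewrite -[RHS]cosD2pi addrAC.
Qed.

(** The slope p is a parameter of its own, frozen while y moves: at the points compared the two
    slopes agree, so differentiating in y never produces a second derivative of u. *)
Definition jump_kernel (p y b : R) : R :=
  (p * sinh (u y + h2) + sin (y - b)) / (cosh (u y + h2) - cos (y - b)).

Let jump_kernel_lip p b x y : `|p| <= Z ->
  `|jump_kernel p x b - jump_kernel p y b| <=
  (1 + Z ^+ 2) / (cosh h2 - 1) * `|x - y|.
Proof.
move=> pZ; pose dk z :=
  ((p * cosh (depth z) * du z + cos (z - b)) * (cosh (depth z) - cos (z - b))
    - (p * sinh (depth z) + sin (z - b)) * (sinh (depth z) * du z + sin (z - b)))
  / (cosh (depth z) - cos (z - b)) ^+ 2.
have dkK z : `|dk z| <= (1 + Z ^+ 2) / (cosh h2 - 1).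
  have Q0 := denom_gt0 z (z - b).
  apply: le_trans (poisson_derivative_le (cosh2B1 _) (cos2Dsin2 _) pZ (duZ z) Q0) _.
  rewrite ler_pM2l; last by have := sqr_ge0 Z; lra.
  by rewrite lef_pV2 ?posrE.
have fE z : deriv_at (fun z => jump_kernel p z b) z (dk z).
  rewrite (_ : (fun z => _) =
    (fun y => (p * sinh (depth y) + sin (y + - b)) / (cosh (depth y) - cos (y + - b)))); last first.
    by apply/funext => t; rewrite /jump_kernel /depth [u t + h2]addrC.
  have shE := deriv_at_comp (f := @sinh R) (deriv_at_sinh _) (depthE z).
  have chE := deriv_at_comp (f := @cosh R) (deriv_at_cosh _) (depthE z).
  have psE := deriv_atM (deriv_at_cst p z) shE.
  have sE := deriv_at_shift (f := @sin R) (is_derive_sin (z + - b)).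
  have cE := deriv_at_shift (f := @cos R) (is_derive_cos (z + - b)).
  have Q0 : cosh (depth z) - cos (z + - b) != 0 by rewrite gt_eqF.
  have := deriv_at_div (g := fun y => cosh (depth y) - cos (y + - b)) (x := z) Q0 (deriv_atD psE sE) (deriv_atB chE cE).
  by rewrite /dk mul0r add0r opprK mulrA.
exact: (lipschitz_of_derive fE dkK y x).
Qed.

Definition jump_integrand (x b : R) : R :=
  (du x * sinh (u x + h2) + sin (x - b)) * varpi2 kp km rp rm h2 u b /
  (cosh (u x + h2) - cos (x - b)).

Let jump_integrandE x b :
  jump_integrand x b = varpi2 kp km rp rm h2 u b * jump_kernel (du x) x b.
Proof. by rewrite /jump_integrand /jump_kernel mulrAC mulrC mulrA. Qed.

Let jump_kernel_cont p x b : {for b, continuous (jump_kernel p x)}.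
Proof.
apply: continuous_atM.
  apply: continuous_atD; first exact: continuous_at_cst.
  exact/continuous_at_reflect/continuous_sin.
apply: continuous_atV; first by have := denom_gt0 x (x - b); rewrite /depth [h2 + u x]addrC => /gt_eqF ->.
apply: continuous_atB; first exact: continuous_at_cst.
exact/continuous_at_reflect/continuous_cos.
Qed.

Let jump_integrand_cont x : continuous (jump_integrand x).
Proof.
rewrite (_ : jump_integrand x = fun b => varpi2 kp km rp rm h2 u b * jump_kernel (du x) x b).
  move=> b; apply: continuous_atM; first exact: varpi2_continuous.
  exact: jump_kernel_cont.
by apply/funext => b; exact: jump_integrandE.
Qed.

Lemma pv_jump x : pv x (jump_integrand x) = torus_int (jump_integrand x).
Proof.
apply: pv_periodic; first exact: jump_integrand_cont.
move=> b; rewrite /jump_integrand varpi2_periodic cos_shift.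
congr (_ * _ / _); congr (_ + _).
by rewrite -[RHS]opprK -[in RHS]sinN -[in RHS]sinD2pi -sinN; congr sin; ring.
Qed.

Lemma jump_diff_le x h : du (x + h) = du x ->
  `|pv (x + h) (jump_integrand (x + h)) - pv x (jump_integrand x)| <=
  4 * pi * (pi * `|calA kp km rp rm| * (1 + Z ^+ 2) / (sinh h2 * (cosh h2 - 1))) * Z * `|h|.
Proof.
move=> dux; rewrite !pv_jump -torus_intB; [|exact: jump_integrand_cont..].
apply: le_trans (torus_int_le (K := `|calA kp km rp rm| * (2 * pi * (Z / sinh h2))
  * ((1 + Z ^+ 2) / (cosh h2 - 1) * `|h|)) _ _) _.
- by move=> b; apply: continuous_atB; exact: jump_integrand_cont.
- move=> b; rewrite !jump_integrandE dux -mulrBr normrM ler_pM//.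
    exact: varpi2_le.
  by have := @jump_kernel_lip (du x) b (x + h) x (duZ x); rewrite addrAC subrr add0r.
- rewrite le_eqVlt; apply/orP; left; apply/eqP.
  by field; rewrite !gt_eqF ?sinh_gt0.
Qed.

End Vorticity.
End RegularTerm.

(** * The decay rate *)

Section DecayRate.
Context {R : realType}.
Implicit Types z : R.

(** Write a = sinh^2 (pi z / 2), S = sinh (pi z), C = cosh (pi z). With (1 - a)^-2 >= 1 + 2 a it
    remains to see a + 3 z S <= pi z C + pi z S / 2. Since 4 a <= pi z S and S <= C, this follows
    from 3 <= (5 / 4) pi. *)
Lemma damping_ge z : 0 <= z -> calP z < 1 -> 1 - calP z <= damping z /\ z < 1.
Proof.
move=> z0; have p0 := @pi_gt0 R; have p12 := @pi_gt_12_5 R.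
rewrite /calP /damping [z * pi]mulrC.
have y0 : 0 <= pi * z by rewrite mulr_ge0// ltW.
have C1 := cosh_ge1 (pi * z); have SC := sinh_lt_cosh (pi * z).
have S0 := sinh_ge0 y0.
have q0 : 0 <= sinh (pi * z / 2) by rewrite sinh_ge0// divr_ge0.
have qyS : 4 * sinh (pi * z / 2) ^+ 2 <= pi * z * sinh (pi * z).
  have y2 : 0 <= pi * z / 2 by rewrite divr_ge0.
  rewrite [sinh (pi * z)]sinh_half; have := ler_wpM2l q0 (sinh_le_cosh y2); lra.
have zy : 12 / 5 * (z * sinh (pi * z)) <= pi * (z * sinh (pi * z)).
  exact: (ler_wpM2r (mulr_ge0 z0 S0) (ltW p12)).
have yC : pi * z * sinh (pi * z) <= pi * z * cosh (pi * z).
  by rewrite ler_wpM2l// ltW.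
have yC1 : pi * z <= pi * z * cosh (pi * z) by rewrite ler_peMr.
have zpi : 12 / 5 * z <= pi * z by rewrite ler_wpM2r// ltW.
have yS0 : 0 <= pi * z * sinh (pi * z) by exact: mulr_ge0.
move: q0 qyS zy yC yC1 zpi yS0.
set a := sinh (pi * z / 2) ^+ 2; move: (sinh (pi * z)) (cosh (pi * z)) => S C.
have a0 : 0 <= a by exact: sqr_ge0.
clearbody a => _ qyS zy yC yC1 zpi yS0.
have X0 : 0 <= ((1 - a) ^+ 2)^-1 by rewrite invr_ge0 sqr_ge0.
(* For a >= 1 the first bracket of [calP] is only known to be at least -1, the value it takes at a =
   1 by the convention on inverses; but then pi z S >= 4, and [calP z] exceeds 1 all the same. *)
have [a1|a1] := leP 1 a; first by move=> H; exfalso; lra.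
have X1 : 1 + 2 * a <= ((1 - a) ^+ 2)^-1.
  rewrite -[leRHS]mul1r ler_pdivlMr ?exprn_gt0 ?subr_gt0//.
  have : 0 <= a * a * (3 - 2 * a) by rewrite !mulr_ge0//; lra.
  lra.
by move=> H; split; lra.
Qed.

(** The gain of the singular term minus the loss of the jump term, both relative to an increment of
    size z h. *)
Definition decay_rate (kp km rp rm h2 z : R) : R :=
  kp * (rm - rp) / 4 * damping z
  - pi * `|calA kp km rp rm| * (1 + z ^+ 2) / (sinh h2 * (cosh h2 - 1)).

(** The loss is compared with the term of the slope condition that is linear in z. From z < 1 one
    gets 1 + z^2 <= 2, and sinh^2 h2 = (cosh h2 - 1) (cosh h2 + 1) >= (cosh h2 - 1)^2 converts the
    denominators. Strictness of the condition excludes z = 0. *)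
Lemma decay_rate_gt0 (kp km rp rm h2 : R) (f0 : R -> R) :
  0 < kp -> 0 < rm - rp -> 0 < h2 -> slope_condition kp km rp rm h2 f0 ->
  let z := normLoo (derive1 f0) in
  0 < z /\ 0 < decay_rate kp km rp rm h2 z.
Proof.
move=> kp0 r0 h0; rewrite /slope_condition /decay_rate /=.
set z := normLoo (derive1 f0); set M := normLoo f0; set a := `|calA kp km rp rm|.
have M0 : 0 <= M := normLoo_ge0 f0; have z0 : 0 <= z := normLoo_ge0 (derive1 f0).
have a0 : 0 <= a := normr_ge0 _; have p0 := @pi_gt0 R.
have c0 : 0 < cosh h2 - 1 by rewrite subr_gt0 cosh_gt1.
have s0 := sinh_gt0 h0; have SM : sinh h2 <= sinh (M + h2) by rewrite sinh_homo// lerDr.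
have CM := cosh_gt0 (M + h2); have S0 := lt_le_trans s0 SM.
have cs : sinh h2 ^+ 2 = (cosh h2 - 1) * (cosh h2 + 1).
  have -> : (cosh h2 - 1) * (cosh h2 + 1) = cosh h2 ^+ 2 - 1 by ring.
  by have := cosh2B1 h2; lra.
clearbody a M; move: CM SM S0; move: (cosh (M + h2)) (sinh (M + h2)) => C S CM SM S0.
set T1 := pi * a * (C / _) * _; set T2 := 2 * pi * a * (S ^+ 2 / _) * _.
set B := S / (cosh h2 - 1) ^+ 3.
have pa : 0 <= pi * a by exact: (mulr_ge0 (ltW p0) a0).
have c2 : 0 <= (cosh h2 - 1) ^+ 2 by exact: sqr_ge0.
have c3 : 0 <= (cosh h2 - 1) ^+ 3 by rewrite exprn_ge0// ltW.
have T10 : 0 <= T1 by exact: (mulr_ge0 (mulr_ge0 pa (divr_ge0 (ltW CM) c2)) (sqr_ge0 z)).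
have T20 : 0 <= T2.
  rewrite /T2 -[2 * pi * a]mulrA.
  exact: (mulr_ge0 (mulr_ge0 (mulr_ge0 (ler0n _ 2) pa) (divr_ge0 (sqr_ge0 S) c3)) (sqr_ge0 z)).
have B0 : 0 <= B by exact: (divr_ge0 (ltW S0) c3).
have aB0 : 0 <= 2 * pi * a * B by have := mulr_ge0 pa B0; lra.
set k := kp * (rm - rp) / 4; have k0 : 0 < k by rewrite divr_gt0// mulr_gt0.
clearbody T1 T2 k => H.
have zp : 0 < z.
  rewrite lt0r z0 andbT; apply: contraTneq isT => zz.
  by move: H; rewrite zz !mulr0 mul0r; lra.
have H2 : 2 * pi * a * B < k * (1 - calP z).
  rewrite -(ltr_pM2r zp); lra.
have P1 : calP z < 1.
  by rewrite -subr_gt0 -(pmulr_rgt0 _ k0); exact: le_lt_trans H2.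
have [dz z1] := damping_ge z0 P1.
split=> //; rewrite subr_gt0.
apply: lt_le_trans (ler_wpM2l (ltW k0) dz).
apply: le_lt_trans H2.
suff HB : (1 + z ^+ 2) / (sinh h2 * (cosh h2 - 1)) <= 2 * B.
  have := ler_wpM2l (mulr_ge0 (ltW p0) a0) HB.
  by rewrite mulrA; lra.
have d0 := mulr_gt0 s0 c0.
rewrite /B [2 * (_ / _)]mulrA ler_pdivrMr// [leRHS]mulrAC ler_pdivlMr ?exprn_gt0//.
have z2 : 1 + z ^+ 2 <= 2.
  by have : z ^+ 2 <= 1 by [rewrite exprn_ile1// ltW]; lra.
have ss : sinh h2 ^+ 2 <= S * sinh h2 by rewrite expr2 ler_wpM2r// ltW.
have e : (1 + z ^+ 2) * (cosh h2 - 1) ^+ 3 =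
   (cosh h2 - 1) * ((1 + z ^+ 2) * (cosh h2 - 1) ^+ 2) by ring.
rewrite e (_ : 2 * S * (sinh h2 * (cosh h2 - 1)) = (cosh h2 - 1) * (2 * (S * sinh h2))); last by ring.
rewrite ler_pM2l//; apply: (le_trans (y := 2 * (cosh h2 - 1) ^+ 2)).
  by rewrite ler_wpM2r ?sqr_ge0.
by rewrite ler_pM2l//; apply: le_trans ss; rewrite cs expr2 ler_pM2l//; lra.
Qed.
End DecayRate.

Section DecayRateRegularity.
Context {R : realType}.
Variables kp km rp rm h2 : R.

Lemma damping_nonincreasing (y z : R) : 0 <= y -> y <= z -> damping z <= damping y.
Proof.
move=> y0 yz; have p0 := @pi_gt0 R; have pp0 := ltW p0.
have yz2 : pi * y / 2 <= pi * z / 2 by rewrite ler_pM2r// ler_pM2l.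
have y20 : 0 <= pi * y / 2 by rewrite divr_ge0// mulr_ge0.
have pyz : pi * y <= pi * z by rewrite ler_pM2l.
have py0 : 0 <= pi * y by rewrite mulr_ge0.
have s1 := sinh_homo yz2; have s2 := sinh_homo pyz.
have s10 := sinh_ge0 y20; have s20 := sinh_ge0 py0.
have sq : sinh (pi * y / 2) ^+ 2 <= sinh (pi * z / 2) ^+ 2.
  by rewrite lerXn2r ?nnegrE// (le_trans s10).
have : y * sinh (pi * y) <= z * sinh (pi * z) by apply: ler_pM.
by rewrite /damping; move: sq; lra.
Qed.

Lemma decay_rate_continuous (z : R) : {for z, continuous (decay_rate kp km rp rm h2)}.
Proof.
have idc : continuous (fun z : R => z) by move=> y; exact: cvg_id.
have pzc : continuous (fun z : R => pi * z).
  by apply: continuous_funM => //; exact: continuous_fun_cst.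
have s1c : continuous (fun z : R => sinh (pi * z)).
  exact: (continuous_fun_comp (@continuous_sinh R) pzc).
have pz2c : continuous (fun z : R => pi * z / 2).
  by apply: continuous_funM => //; exact: continuous_fun_cst.
have s2c : continuous (fun z : R => sinh (pi * z / 2)).
  exact: (continuous_fun_comp (@continuous_sinh R) pz2c).
have dc : continuous (@damping R).
  apply: continuous_funB.
    apply: continuous_funB; first exact: continuous_fun_cst.
    apply: continuous_funM; first exact: continuous_fun_cst.
    exact: continuous_funM.
  apply: continuous_funM => //.
  by apply: continuous_funM => //; exact: continuous_fun_cst.
apply: continuous_atB.
  by apply: continuous_atM; [exact: continuous_at_cst|exact: dc].
apply: continuous_atM; last exact: continuous_at_cst.
apply: continuous_atM; first exact: continuous_at_cst.
apply: continuous_atD; first exact: continuous_at_cst.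
by apply: continuous_atM; exact: idc.
Qed.

(** Gives the slope room to exceed its initial value a little before the contradiction is
    reached. *)
Lemma decay_rate_perturb (z m : R) : m < decay_rate kp km rp rm h2 z ->
  exists2 e, 0 < e & m < decay_rate kp km rp rm h2 (z + e).
Proof.
move=> mz; have := @decay_rate_continuous z _ (lt_nbhsr mz).
move=> /nbhs_ballP[d d0 dP]; exists (d / 2); first by rewrite divr_gt0.
apply: dP; rewrite /ball/= opprD addrA subrr sub0r normrN gtr0_norm ?divr_gt0//.
by rewrite ltr_pdivrMr// ltr_pMr// ltr1n.
Qed.

(** The prefactor k / (4 pi) meets the pi of [singular_diff_le], and 1 / (4 pi) cancels the 4 pi of
    [jump_diff_le]; what remains are the two constituents of [decay_rate]. *)
Lemma muskat_rhs_diff_le (u : R -> R) (Z Lam x h : R) :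
  0 < kp * (rm - rp) -> 0 < h2 ->
  (forall y, deriv_at u y (derive1 u y)) -> periodic u (pi *+ 2) ->
  continuous (derive1 u) -> (forall y, `|derive1 u y| <= Z) ->
  (forall y z, `|derive1 u y - derive1 u z| <= Lam * `|y - z|) ->
  (forall y, 0 < u y) -> 0 <= damping Z ->
  (forall y, u (y + h) - u y <= u (x + h) - u x) ->
  muskat_rhs kp km rp rm h2 u (x + h) - muskat_rhs kp km rp rm h2 u x <=
  - (kp * (rm - rp) / 4 * damping Z) * (u (x + h) - u x)
  + pi * `|calA kp km rp rm| * (1 + Z ^+ 2) / (sinh h2 * (cosh h2 - 1)) * Z * `|h|.
Proof.
move=> k0 h0 uE u_per du_c duZ du_lip u0 dZ x_max; have p0 := @pi_gt0 R.
have dux : derive1 u (x + h) = derive1 u x.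
  have wE y := deriv_atB (deriv_at_shift (uE (y + h))) (uE y).
  by apply/subr0_eq; exact: deriv_at_max (wE x) x_max.
have S := singular_diff_le uE u_per du_c duZ du_lip x_max dZ.
have J := le_trans (ler_norm _)
  (@jump_diff_le R u kp km rp rm h2 Z uE u_per du_c duZ u0 h0 x h dux).
set B := pi * `|calA kp km rp rm| * (1 + Z ^+ 2) / (sinh h2 * (cosh h2 - 1)) in J *.
have E y : muskat_rhs kp km rp rm h2 u y =
  kp * (rm - rp) / (4 * pi) * pv 0 (singular_integrand u (derive1 u) y)
  + (4 * pi)^-1 * pv y (jump_integrand u kp km rp rm h2 y) by reflexivity.
have lin (a b c d e f : R) :
  a * b + c * d - (a * e + c * f) = a * (b - e) + c * (d - f) by ring.
rewrite !E lin.
have pi4 : 0 < 4 * pi :> R by rewrite mulr_gt0.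
apply: lerD.
  apply: le_trans (ler_wpM2l (ltW (divr_gt0 k0 pi4)) S) _.
  rewrite le_eqVlt; apply/orP; left; apply/eqP.
  have aux (q k d w : R) : q != 0 -> k / (4 * q) * (- (q * d) * w) = - (k / 4 * d) * w.
    by move=> q0; field.
  by apply: aux; rewrite gt_eqF.
rewrite mulrC ler_pdivrMr//; apply: le_trans J _.
have aux (q b z a : R) : 4 * q * b * z * a = b * z * a * (4 * q) by ring.
by rewrite aux.
Qed.

End DecayRateRegularity.

(** * Sobolev regularity *)

Section L2Torus.
Context {R : realType}.
Notation mu := (@lebesgue_measure R).
Implicit Types f g : R -> R.

Lemma L2B f g : L2 f -> L2 g -> L2 (fun x => f x - g x).
Proof.
move=> [f2 mf] [g2 mg]; split; last exact: measurable_funB.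
have mNg : measurable_fun setT (fun x => - g x) by exact: measurableT_comp.
rewrite /finite_norm.
apply: le_lt_trans (@eminkowski _ _ R (torus_measure R) f (fun x => - g x) 2%:E mf mNg _) _.
  by rewrite lee_fin ler1n.
apply: lte_add_pinfty; first exact: f2.
rewrite (_ : EFin \o _ = (\- (EFin \o g))%E)//.
by rewrite oppe_Lnorm; exact: g2.
Qed.

(** The constant of the Cauchy-Schwarz inequality against the function 1: the square root of the
    length of the torus. *)
Definition L2_to_L1 : R := fine ((torus_measure R setT) `^ 2^-1)%E.

Lemma L2_to_L1_ge0 : 0 <= L2_to_L1.
Proof. by rewrite fine_ge0// poweR_ge0. Qed.

Lemma torus_measure_fin : (torus_measure R setT \is a fin_num)%E.
Proof.
rewrite /torus_measure/= /mrestr setTI /torus lebesgue_measure_itv/=.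
by case: ifPn.
Qed.

Lemma L2_integral_le f : L2 f ->
  (\int[mu]_(x in torus R) `|f x|%:E <= (L2_to_L1 * torus_norm 2%:E f)%:E)%E.
Proof.
move=> [f2 mf].
have p2 : (0 : R) < 2 by [].
have h22 : 2^-1 + 2^-1 = 1 :> R by field.
have mabs : measurable_fun setT (fun x => `|f x|%:E).
  by apply/measurable_EFinP; exact: measurableT_comp.
have H := @hoelder _ _ R (torus_measure R) f (cst 1) 2 2 mf (measurable_cst _) p2 p2 h22.
rewrite (_ : (\int[mu]_(x in torus R) `|f x|%:E =
              \int[torus_measure R]_(x in torus R) `|f x|%:E)%E); last first.
  apply/esym; apply: eq_measure_integral => A mA AT.
  by rewrite /torus_measure/= /mrestr setIidl.
have f0 (x : R) : setT x -> (0 <= `|f x|%:E)%E by [].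
have := @ge0_subset_integral _ _ R (torus_measure R) _ setT (@measurable_torus R)
  measurableT _ mabs f0 (@subsetT _ _).
move=> /le_trans; apply.
rewrite EFinM muleC /torus_norm /L2_to_L1 !fineK; first last.
- by rewrite ge0_fin_numE ?Lnorm_ge0.
- by rewrite fin_num_poweR// torus_measure_fin.
apply: le_trans _ (le_trans H _).
  rewrite Lnorm1; apply: ge0_le_integral => //.
  - by apply/measurable_EFinP; apply: measurableT_comp => //; apply: measurable_funM => //.
  - by move=> x _ /=; rewrite mulr1.
by rewrite lee_pmul// ?Lnorm_ge0// (Lnorm_cst1 (torus_measure R) 2).
Qed.

Lemma L2_integrable f : L2 f -> mu.-integrable (torus R) (EFin \o f).
Proof.
move=> f2; apply/integrableP; split.
  by apply/measurable_EFinP; apply: measurable_funS f2.2.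
by apply: le_lt_trans (L2_integral_le f2) _; rewrite ltry.
Qed.

Lemma torus_norm2_ge0 f : 0 <= torus_norm 2%:E f.
Proof. by rewrite fine_ge0// Lnorm_ge0. Qed.

Lemma L2_pairing_integrable f g K : L2 f -> continuous g -> (forall x, `|g x| <= K) ->
  mu.-integrable (torus R) (EFin \o (fun x => f x * g x)).
Proof.
move=> f2 cg gK; have K0 : 0 <= K := le_trans (normr_ge0 _) (gK 0).
have mfg : measurable_fun (torus R) (fun x => f x * g x).
  apply: measurable_funM; first exact: measurable_funS f2.2.
  by apply: measurable_funS (continuous_measurable_fun cg).
apply: (@le_integrable _ _ _ mu _ _ _ (fun x => (K * `|f x|)%:E)).
- exact: measurable_torus.
- exact/measurable_EFinP.
- move=> x _ /=; rewrite lee_fin !normrM [`|K|]ger0_norm// normr_id mulrC.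
  by rewrite ler_wpM2r.
- have := @integrableZl _ _ _ mu (torus R) (@measurable_torus R) K _ (integrable_norm (L2_integrable f2)).
  by [].
Qed.

Lemma L2_pairing_le f g K : L2 f -> continuous g -> (forall x, `|g x| <= K) ->
  `|torus_int (fun x => f x * g x)| <= K * (L2_to_L1 * torus_norm 2%:E f).
Proof.
move=> f2 cg gK; have K0 : 0 <= K := le_trans (normr_ge0 _) (gK 0).
have fi := integrable_norm (L2_integrable f2).
apply: le_trans (le_normr_Rintegral (@measurable_torus R) (L2_pairing_integrable f2 cg gK)) _.
apply: (le_trans (y := \int[mu]_(x in torus R) (K * `|f x|))).
  apply: le_Rintegral.
  - exact: measurable_torus.
  - exact: integrable_norm (L2_pairing_integrable f2 cg gK).
  - exact: @integrableZl _ _ _ mu (torus R) (@measurable_torus R) K _ fi.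
  - by move=> x _; rewrite normrM mulrC ler_wpM2r.
rewrite RintegralZl; [|exact: measurable_torus|exact: fi].
rewrite ler_wpM2l// -lee_fin /Rintegral fineK; first exact: L2_integral_le.
by apply: (integrable_fin_num (@measurable_torus R)) => //; exact: fi.
Qed.

End L2Torus.

(** * Periodic primitives and peaked test functions *)

Section TestFunctions.
Context {R : realType}.
Notation mu := (@lebesgue_measure R).
Implicit Types f g : R -> R.

Lemma periodic_FTC f F : (forall x, deriv_at F x (f x)) -> continuous f ->
  periodic F (pi *+ 2) -> torus_int f = 0.
Proof.
move=> FE cf pF; have p0 := @pi_gt0 R.
rewrite /torus_int /torus (FTC_Rintegral FE)//; last by lra.
by rewrite -(pF (- pi)) mulr2n addrA addNr add0r subrr.
Qed.

(** For the bound: two values of G differ by at most the integral of |g|, and since G has mean zero,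
    G y is the average of the differences G y - G z. *)
Lemma periodic_primitive g : continuous g -> periodic g (pi *+ 2) ->
  torus_int g = 0 -> exists G, [/\ forall x, deriv_at G x (g x),
    periodic G (pi *+ 2), torus_int G = 0 &
    forall x, `|G x| <= torus_int (fun x => `|g x|)].
Proof.
move=> cg pg g0; have [G0 dG0] := continuous_primitive cg.
have p0 := @pi_gt0 R; have pp : - pi <= pi :> R by lra.
have cG0 := derive_continuous dG0.
pose m := torus_int G0 / (2 * pi).
pose G x := G0 x - m.
have dG x : deriv_at G x (g x).
  by have := deriv_atB (dG0 x) (deriv_at_cst m x); rewrite subr0.
have cG := derive_continuous dG.
have pG : periodic G (pi *+ 2).
  have dd y : deriv_at (fun x => G (x + pi *+ 2) - G x) y 0.
    by rewrite -(subrr (g y)) -{1}(pg y); exact: deriv_atB (deriv_at_shift (dG _)) (dG y).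
  move=> x; apply/eqP; rewrite -subr_eq0; apply/eqP.
  have := is_derive_0_is_cst x (- pi) dd; rewrite /= => ->.
  have : torus_int g = G pi - G (- pi) by exact: FTC_Rintegral.
  by rewrite mulr2n addrA addNr add0r g0 => <-.
have G_int : torus_int G = 0.
  rewrite /G torus_intB//; last by move=> x; exact: continuous_at_cst.
  have aux (q a : R) : 0 < q -> a - a / (2 * q) * (q - - q) = 0.
    by move=> q0; field; rewrite gt_eqF.
  by rewrite [X in _ - X]Rintegral_itv_cst// /m; exact: aux.
exists G; split=> // x.
have cN : continuous (fun x => `|g x|).
  by move=> y; apply: continuous_comp; [exact: cg|exact: norm_continuous].
have diff y z : - pi <= y -> y <= z -> z <= pi ->
    `|G z - G y| <= torus_int (fun x => `|g x|).
  move=> py yz zp; rewrite -(FTC_Rintegral dG)//.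
  apply: le_trans (le_normr_Rintegral _ (continuous_integrable y z cg)) _ => //.
  have yp := le_trans yz zp; have iN a b := continuous_integrable a b cN.
  rewrite /torus_int /torus (Rintegral_itv_split py yp (iN _ _)).
  rewrite (Rintegral_itv_split yz zp (iN _ _)).
  rewrite addrCA lerDl addr_ge0//; exact: Rintegral_ge0.
have [y yp <-] := periodic_repr x pG.
have H : 2 * pi * G y = torus_int (fun z => G y - G z).
  rewrite torus_intB//; last by move=> z; exact: continuous_at_cst.
  by rewrite G_int subr0 [RHS]Rintegral_itv_cst//; ring.
have : `|torus_int (fun z => G y - G z)| <= torus_int (fun x => `|g x|) * (pi - - pi).
  have dyc z : {for z, continuous (fun z => G y - G z)}.
    by apply: continuous_atB; [exact: continuous_at_cst|exact: cG].
  apply: Rintegral_norm_le => //; first exact: (continuous_integrable _ _ dyc).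
  move=> z zp; have [yz|/ltW zy] := leP y z; last by apply: diff; lra.
  by rewrite distrC; apply: diff; lra.
rewrite -H normrM gtr0_norm ?mulr_gt0//.
rewrite (_ : pi - - pi = 2 * pi); last by ring.
by rewrite [leRHS]mulrC ler_pM2l// mulr_gt0.
Qed.

Section Kernel.
Variable nu : R.
Hypothesis nu0 : 0 < nu.

(* An unnormalised Poisson kernel. *)
Definition peak (y : R) : R := (nu + 1 - cos y)^-1.

Let den_gt0 y : 0 < nu + 1 - cos y.
Proof. by rewrite -addrA ltr_wpDr// subr_ge0 cos_le1. Qed.

Lemma peak_gt0 y : 0 < peak y. Proof. by rewrite invr_gt0. Qed.

Definition dpeak (y : R) : R := - sin y / (nu + 1 - cos y) ^+ 2.

Lemma peakE y : deriv_at peak y (dpeak y).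
Proof.
have dE := deriv_atB (deriv_at_cst (nu + 1) y) (is_derive_cos y).
have den0 : nu + 1 - cos y != 0 by rewrite gt_eqF.
have := deriv_atV (f := fun y => nu + 1 - cos y) (x := y) den0 dE.
by rewrite sub0r opprK.
Qed.

Lemma peak_continuous : continuous peak.
Proof. exact: derive_continuous peakE. Qed.

Lemma dpeak_continuous : continuous dpeak.
Proof.
move=> y; have H : {for y, continuous (fun y => nu + 1 - cos y)}.
  by apply: continuous_atB; [exact: continuous_at_cst|exact: continuous_cos].
have : {for y, continuous dpeak}; last by [].
apply: continuous_atM; first by apply: cvgN; exact: continuous_sin.
apply: continuous_atV; first by rewrite expf_neq0// gt_eqF.
by apply: continuous_atM.
Qed.

Lemma peak_periodic : periodic peak (pi *+ 2).
Proof. by move=> y; rewrite /peak cosD2pi. Qed.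

Lemma peak_far y d : 0 < d -> d <= `|y| -> `|y| <= pi ->
  peak y <= pi ^+ 2 / (2 * d ^+ 2).
Proof.
move=> d0 dy yp; have p0 := @pi_gt0 R.
rewrite /peak -[leLHS]mul1r ler_pdivrMr//.
rewrite mulrAC ler_pdivlMr ?mulr_gt0 ?exprn_gt0// mul1r.
have := jordan yp; rewrite cos_half -[sin (y / 2) ^+ 2]real_normK ?num_real//.
move: `|sin _| => s ys.
have : d ^+ 2 <= (pi * s) ^+ 2.
  by rewrite lerXn2r ?nnegrE ?(ltW d0) ?(le_trans (normr_ge0 _) ys)// (le_trans dy).
have : 0 <= pi ^+ 2 * nu by rewrite mulr_ge0 ?sqr_ge0// ltW.
lra.
Qed.

End Kernel.

(** With nu = t^2, on [- t, t] the denominator nu + 2 sin^2 (y / 2) is at most 2 t^2, so this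
    interval alone contributes 2 t / (2 t^2). *)
Lemma peak_mass (t : R) : 0 < t -> t <= pi -> t^-1 <= torus_int (peak (t ^+ 2)).
Proof.
move=> t0 tp; have p0 := @pi_gt0 R; have t20 : 0 < t ^+ 2 by rewrite exprn_gt0.
have kc := peak_continuous t20.
rewrite /torus_int /torus (@Rintegral_itv_split _ _ _ (- t)); [|lra|lra|exact: continuous_integrable].
rewrite (@Rintegral_itv_split _ _ (- t) t); [|lra|lra|exact: continuous_integrable].
rewrite addrCA ler_wpDr//.
  by rewrite addr_ge0//; apply: Rintegral_ge0 => x _; rewrite ltW// peak_gt0.
have -> : t^-1 = \int[mu]_(x in `[- t, t]) (2 * t ^+ 2)^-1.
  rewrite Rintegral_itv_cst; last by lra.
  by field; rewrite gt_eqF.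
apply: le_Rintegral => //.
- by apply: continuous_integrable => x; exact: continuous_at_cst.
- exact: continuous_integrable.
- move=> x /=; rewrite in_itv/= => xt.
  have den0 : 0 < t ^+ 2 + 1 - cos x by rewrite -addrA ltr_wpDr// subr_ge0 cos_le1.
  rewrite lef_pV2 ?posrE ?mulr_gt0// cos_half.
  have := sin_norm_le (x / 2); rewrite normrM [`|2^-1|]gtr0_norm//.
  rewrite -[sin (x / 2) ^+ 2]real_normK ?num_real//.
  have : `|x| <= t by rewrite ler_norml.
  have := normr_ge0 (sin (x / 2)); move: `|sin _| `|x| => s a; nra.
Qed.

(* No limit is needed: the mass of [peak] blows up as nu tends to 0 while its values
   away from 0 stay bounded. *)
Lemma approx_identity g B : continuous g -> 0 <= B ->
  periodic g (pi *+ 2) ->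
  (forall nu, 0 < nu -> `|torus_int (fun y => g y * peak nu y)| <=
                        B * torus_int (peak nu)) ->
  `|g 0| <= B.
Proof.
move=> cg B0 pg H; have p0 := @pi_gt0 R; have pp : - pi <= pi :> R by lra.
have [K K0 gK] := periodic_bounded cg pg.
apply/ler_addgt0Pr => e e0; have e2 : 0 < e / 2 by rewrite divr_gt0.
have [d d0 dP] : exists2 d, 0 < d & forall y, `|y| < d -> `|g y - g 0| <= e / 2.
  have /cvgrPdist_le/(_ _ e2)/nbhs_ballP[d d0 dP] := cg 0.
  exists d => // y yd; rewrite distrC; apply: dP.
  by rewrite /ball/= sub0r normrN.
pose M := 2 * K * (pi ^+ 2 / (2 * d ^+ 2)).
have M0 : 0 <= M.
  apply: mulr_ge0; first by rewrite mulr_ge0.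
  by apply: divr_ge0; rewrite ?sqr_ge0// mulr_ge0// sqr_ge0.
(* M bounds the integrand away from 0. This t makes the far contribution 2 pi M at most (e / 2) / t,
   hence at most e / 2 times the mass of the peak. *)
pose t := Num.min pi (e / (4 * pi * (M + 1))).
have M1 : 0 < 4 * pi * (M + 1) by apply: mulr_gt0; [rewrite mulr_gt0|lra].
have t0 : 0 < t by rewrite lt_min p0 divr_gt0.
have tp : t <= pi by rewrite ge_min lexx.
have te : t <= e / (4 * pi * (M + 1)) by rewrite ge_min lexx orbT.
have nu0 : 0 < t ^+ 2 by rewrite exprn_gt0.
have mass := peak_mass t0 tp.
have {}H := H _ nu0.
set k := peak (t ^+ 2) in H mass; set Z := torus_int k in H mass.
have kc : continuous k := peak_continuous nu0.
have Z0 : 0 < Z by apply: lt_le_trans mass; rewrite invr_gt0.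
have gkc y : {for y, continuous (fun y => g y * k y)}.
  by apply: continuous_atM; [exact: cg|exact: kc].
have g0kc y : {for y, continuous (fun y => g 0 * k y)}.
  by apply: continuous_atM; [exact: continuous_at_cst|exact: kc].
have g0Z : g 0 * Z = torus_int (fun y => g y * k y) - torus_int (fun y => g y * k y - g 0 * k y).
  rewrite torus_intB// torus_intZ// -/Z; ring.
have dc y : {for y, continuous (fun y => g y * k y - g 0 * k y)}.
  by apply: continuous_atB; [exact: gkc|exact: g0kc].
have ekc y : {for y, continuous (fun y => e / 2 * k y)}.
  by apply: continuous_atM; [exact: continuous_at_cst|exact: kc].
have mc y : {for y, continuous (fun y => e / 2 * k y + M)}.
  by apply: continuous_atD; [exact: ekc|exact: continuous_at_cst].
have D : `|torus_int (fun y => g y * k y - g 0 * k y)| <= e / 2 * Z + 2 * pi * M.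
  have -> : e / 2 * Z + 2 * pi * M = torus_int (fun y => e / 2 * k y + M).
    rewrite torus_intD; [|exact: ekc|by move=> y; exact: continuous_at_cst].
    by rewrite torus_intZ// torus_int_cst.
  have dci := continuous_integrable (- pi) pi dc.
  have Dn := le_normr_Rintegral (@measurable_torus R) dci.
  apply: le_trans Dn _.
  apply: le_Rintegral.
  - exact: measurable_torus.
  - exact: (integrable_norm dci).
  - exact: (continuous_integrable (- pi) pi mc).
  move=> y; rewrite /torus/= in_itv/= -ler_norml => yp.
  have k0 : 0 < k y := peak_gt0 nu0 y.
  rewrite -mulrBl normrM (gtr0_norm k0).
  have [yd|dy] := ltP `|y| d.
    by apply: ler_wpDr => //; rewrite ler_pM2r// dP.
  apply: ler_wpDl; first by rewrite mulr_ge0// ltW.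
  apply: ler_pM => //; first exact: ltW.
    by apply: le_trans (ler_normB _ _) _; have := gK y; have := gK 0; lra.
  exact: peak_far.
have g0Z2 : `|g 0| * Z <= B * Z + (e / 2 * Z + 2 * pi * M).
  rewrite -{1}(gtr0_norm Z0) -normrM g0Z.
  by apply: le_trans (ler_normB _ _) _; apply: lerD.
have MZ : 2 * pi * M <= e / 2 * Z.
  apply: (le_trans (y := e / 2 * t^-1)); last by rewrite ler_pM2l.
  rewrite ler_pdivlMr//.
  apply: (le_trans (y := 2 * pi * M * (e / (4 * pi * (M + 1))))).
    by apply: ler_wpM2l => //; have := mulr_ge0 (ltW p0) M0; lra.
  rewrite mulrA ler_pdivrMr//.
  rewrite -subr_ge0 (_ : _ - _ = 2 * (e * pi)); last by field.
  by rewrite !mulr_ge0// ltW.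
rewrite -(ler_pM2r Z0); apply: le_trans g0Z2 _; rewrite [(B + e) * Z]mulrDl lerD2l.
have -> : e * Z = e / 2 * Z + e / 2 * Z by field.
by rewrite lerD2l.
Qed.

End TestFunctions.

(** * From the third weak derivative to the slope *)

Section SobolevEmbedding.
Context {R : realType}.
Notation mu := (@lebesgue_measure R).
Implicit Types u v : R -> R.

Lemma weak_derivativeE u v (phi dphi : R -> R) : weak_derivative u v ->
  (forall x, deriv_at phi x (dphi x)) -> continuous dphi ->
  periodic phi (pi *+ 2) ->
  torus_int (fun x => u x * dphi x) = - torus_int (fun x => v x * phi x).
Proof.
move=> uv phiE dphi_c pphi.
have dE : derive1 phi = dphi.
  by apply/funext => x; exact: derive1_deriv_at (phiE x).
rewrite -uv//; last by rewrite dE.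
  by rewrite dE.
by move=> x; case: (phiE x).
Qed.

(** A classical integration by parts trades du for u against p3, and the three weak relations then
    move the derivatives back one at a time. In this way du is never compared pointwise with [D 1],
    which is determined only almost everywhere. *)
Lemma jet_identity u (du : R -> R) D (p0 p1 p2 p3 : R -> R) :
  sobolev_jet 3 u D -> (forall x, deriv_at u x (du x)) -> continuous du ->
  periodic u (pi *+ 2) ->
  (forall x, deriv_at p0 x (p1 x)) -> (forall x, deriv_at p1 x (p2 x)) ->
  (forall x, deriv_at p2 x (p3 x)) -> continuous p3 ->
  periodic p0 (pi *+ 2) ->
  torus_int (fun x => du x * p2 x) = torus_int (fun x => D 3%N x * p0 x).
Proof.
move=> [D0 _ Dw] uE du_c pu p0E p1E p2E p3c pp0.
have pp1 := derive1_periodic pp0 p0E.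
have pp2 := derive1_periodic pp1 p1E.
have p1c := derive_continuous p1E; have p2c := derive_continuous p2E.
have uc := derive_continuous uE.
have w0 := weak_derivativeE (Dw 0%N isT) p2E p3c pp2.
have w1 := weak_derivativeE (Dw 1%N isT) p1E p2c pp1.
have w2 := weak_derivativeE (Dw 2%N isT) p0E p1c pp0.
have ibp : torus_int (fun x => du x * p2 x + u x * p3 x) = 0.
  apply: (@periodic_FTC _ _ (fun x => u x * p2 x)).
  - by move=> x; exact: (deriv_atM (uE x) (p2E x)).
  - by apply: continuous_funD; exact: continuous_funM.
  - by move=> x; rewrite pu pp2.
move: ibp; rewrite torus_intD; [|exact: continuous_funM..].
by move: w0; rewrite D0 w1 w2; lra.
Qed.

Lemma peak_mass_gt0 (nu : R) : 0 < nu -> 0 < torus_int (peak nu).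
Proof.
move=> nu0; have p0 := @pi_gt0 R; have n2 : 0 < nu + 2 by lra.
have le_peak y : (nu + 2)^-1 <= peak nu y.
  rewrite lef_pV2 ?posrE//; first by have := cos_geN1 y; lra.
  by rewrite -addrA ltr_wpDr// subr_ge0 cos_le1.
apply: (lt_le_trans (y := torus_int (fun _ => (nu + 2)^-1))).
  by rewrite torus_int_cst !mulr_gt0// invr_gt0.
apply: le_Rintegral.
- exact: measurable_torus.
- exact: (continuous_integrable (- pi) pi (@continuous_fun_cst R _)).
- exact: (continuous_integrable (- pi) pi (peak_continuous nu0)).
- by move=> y _; exact: le_peak.
Qed.

(** A smoothed Dirac mass minus its mean value; zero mean is what allows periodic primitives. *)
Definition peak_density (nu y : R) : R :=
  (torus_int (peak nu))^-1 * peak nu y - (2 * pi)^-1.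

(** The bounds are uniform in nu: the density is a difference of two probability densities, so its
    L1 norm is at most 2, which bounds [H1]; integrating that bound over the torus gives 4 pi for
    [H0]. *)
Lemma green_function (nu : R) : 0 < nu -> exists H0 H1 : R -> R,
  [/\ forall x, deriv_at H0 x (H1 x),
      forall x, deriv_at H1 x (peak_density nu x),
      periodic H0 (pi *+ 2),
      forall x, `|H0 x| <= 4 * pi & forall x, `|H1 x| <= 2].
Proof.
move=> nu0; have p0 := @pi_gt0 R; have kc := peak_continuous nu0.
have Z0 := peak_mass_gt0 nu0; set Z := torus_int (peak nu) in Z0.
have q0 : 0 <= (2 * pi)^-1 :> R by rewrite invr_ge0 mulr_ge0// ltW.
have ZkC : continuous (fun y => Z^-1 * peak nu y).
  by apply: continuous_funM => //; exact: continuous_fun_cst.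
have dc : continuous (peak_density nu).
  by apply: continuous_funB => //; exact: continuous_fun_cst.
have dp : periodic (peak_density nu) (pi *+ 2).
  by move=> y; rewrite /peak_density peak_periodic.
have pq : 2 * pi * (2 * pi)^-1 = 1 :> R by rewrite divff// mulf_neq0// gt_eqF.
have d0 : torus_int (peak_density nu) = 0.
  rewrite torus_intB//; last exact: continuous_fun_cst.
  by rewrite torus_intZ// torus_int_cst pq mulVf ?gt_eqF// subrr.
have [H1 [H1E H1p H10 H1b]] := periodic_primitive dc dp d0.
have abs_c : continuous (fun x => `|peak_density nu x|).
  by move=> y; apply: continuous_comp; [exact: dc|exact: norm_continuous].
have d2 : torus_int (fun x => `|peak_density nu x|) <= 2.
  have -> : 2 = torus_int (fun y => Z^-1 * peak nu y + (2 * pi)^-1) :> R.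
    rewrite torus_intD//; last exact: continuous_fun_cst.
    by rewrite torus_intZ// torus_int_cst pq mulVf ?gt_eqF.
  apply: le_torus_int => //.
    by apply: continuous_funD => //; exact: continuous_fun_cst.
  move=> y; apply: le_trans (ler_normB _ _) _.
  have Zk : 0 <= Z^-1 * peak nu y.
    by apply: mulr_ge0; [rewrite invr_ge0 ltW|exact: (ltW (peak_gt0 nu0 y))].
  by rewrite !ger0_norm.
have H1b2 x : `|H1 x| <= 2 by exact: le_trans (H1b x) d2.
have H1c := derive_continuous H1E.
have [H0 [H0E H0p _ H0b]] := periodic_primitive H1c H1p H10.
exists H0, H1; split=> // x; apply: le_trans (H0b x) _.
have -> : 4 * pi = torus_int (fun _ => 2) :> R by rewrite torus_int_cst; ring.
apply: le_torus_int => //; last exact: continuous_fun_cst.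
by move=> y; apply: continuous_comp; [exact: H1c|exact: norm_continuous].
Qed.

Section Difference.
Variables (u v du dv : R -> R) (D E : nat -> R -> R).
Hypothesis uD : sobolev_jet 3 u D.
Hypothesis vE : sobolev_jet 3 v E.
Hypothesis uE : forall x, deriv_at u x (du x).
Hypothesis vE' : forall x, deriv_at v x (dv x).
Hypothesis du_c : continuous du.
Hypothesis dv_c : continuous dv.
Hypothesis up : periodic u (pi *+ 2).
Hypothesis vp : periodic v (pi *+ 2).

Let g x := du x - dv x.
Let W x := D 3%N x - E 3%N x.
Let N := L2_to_L1 * torus_norm 2%:E W.

Let D2 : L2 (D 3%N). Proof. by case: uD => _ /(_ 3%N) + _; exact. Qed.
Let E2 : L2 (E 3%N). Proof. by case: vE => _ /(_ 3%N) + _; exact. Qed.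
Let W2 : L2 W. Proof. exact: L2B D2 E2. Qed.

Let g_c : continuous g. Proof. exact: continuous_funB. Qed.

Let g_p : periodic g (pi *+ 2).
Proof.
by move=> x; rewrite /g (derive1_periodic up uE) (derive1_periodic vp vE').
Qed.

Let g_int : torus_int g = 0.
Proof.
apply: (@periodic_FTC _ _ (fun x => u x - v x)) => //.
  by move=> x; exact: deriv_atB (uE x) (vE' x).
by move=> x; rewrite up vp.
Qed.

(** The average of g around a against the peak becomes a pairing of the third derivative with the
    Green function centred at a. Subtracting the constant (2 pi)^-1 from the density costs nothing,
    since g has mean zero. *)
Let pairing nu H0 H1 a : 0 < nu -> (forall x, deriv_at H0 x (H1 x)) ->
  (forall x, deriv_at H1 x (peak_density nu x)) -> periodic H0 (pi *+ 2) ->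
  torus_int (fun s => g (a + s) * peak nu s) =
  torus_int (peak nu) * torus_int (fun y => W y * H0 (y - a)).
Proof.
move=> nu0 H0E H1E H0p; have kc := peak_continuous nu0.
have Z0 := peak_mass_gt0 nu0; set Z := torus_int (peak nu) in Z0 *.
have H0c := derive_continuous H0E.
have [K _ H0K] := periodic_bounded H0c H0p.
have sE (f df : R -> R) : (forall x, deriv_at f x (df x)) ->
    forall x, deriv_at (fun x => f (x - a)) x (df (x - a)).
  by move=> fE x; exact: (deriv_at_shift (f := f) (fE (x - a))).
have d2E x : deriv_at (peak_density nu) x (Z^-1 * dpeak nu x).
  have := deriv_atB (deriv_atM (deriv_at_cst Z^-1 x) (peakE nu0 x)) (deriv_at_cst (2 * pi)^-1 x).
  by rewrite mul0r add0r subr0.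
have dc := derive_continuous d2E.
have p3c : continuous (fun x => Z^-1 * dpeak nu (x - a)).
  apply: continuous_funM; first exact: continuous_fun_cst.
  exact/continuous_funBr/dpeak_continuous.
have pp0 : periodic (fun x => H0 (x - a)) (pi *+ 2).
  by move=> x; rewrite addrAC H0p.
have iu := jet_identity uD uE du_c up (sE _ _ H0E) (sE _ _ H1E) (sE _ _ d2E) p3c pp0.
have iv := jet_identity vE vE' dv_c vp (sE _ _ H0E) (sE _ _ H1E) (sE _ _ d2E) p3c pp0.
have dac := continuous_funBr (c := a) dc.
have H0ac := continuous_funBr (c := a) H0c.
have T : torus_int (fun y => g y * peak_density nu (y - a)) =
         torus_int (fun y => W y * H0 (y - a)).
  have -> : (fun y => W y * H0 (y - a)) =
      (fun y => D 3%N y * H0 (y - a) - E 3%N y * H0 (y - a)).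
    by apply/funext => y; rewrite /W mulrBl.
  have -> : (fun y => g y * peak_density nu (y - a)) =
      (fun y => du y * peak_density nu (y - a) - dv y * peak_density nu (y - a)).
    by apply/funext => y; rewrite /g mulrBl.
  rewrite torus_intB; [|exact: continuous_funM..].
  rewrite iu iv /torus_int RintegralB//.
  - exact: measurable_torus.
  - exact: (L2_pairing_integrable D2 H0ac (fun x => H0K (x - a))).
  - exact: (L2_pairing_integrable E2 H0ac (fun x => H0K (x - a))).
rewrite -T.
have pc : continuous (fun y => g y * peak_density nu (y - a)) by exact: continuous_funM.
have pper : periodic (fun y => g y * peak_density nu (y - a)) (pi *+ 2).
  by move=> y; rewrite g_p addrAC /peak_density peak_periodic.
rewrite -(periodic_shift a pc pper).
have gac : continuous (fun s => g (a + s)) by move=> s; exact: continuous_at_shift.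
have gap : torus_int (fun s => g (a + s)) = 0 by rewrite periodic_shift.
rewrite -torus_intZ; last first.
  apply: continuous_funM => //.
  by rewrite (_ : (fun x => _) = peak_density nu)//; apply/funext => s; rewrite addrAC subrr add0r.
have -> : (fun x => Z * (g (a + x) * peak_density nu (a + x - a))) =
   (fun s => g (a + s) * peak nu s - Z * (2 * pi)^-1 * g (a + s)).
  have aux (z k q c : R) : z != 0 -> z * (c * (z^-1 * k - q)) = c * k - z * q * c.
    by move=> z0; field.
  apply/funext => s; rewrite [a + s - a]addrAC subrr add0r.
  by apply: aux; rewrite gt_eqF.
rewrite torus_intB; [|exact: continuous_funM|].
  by rewrite torus_intZ// gap mulr0 subr0.
by apply: continuous_funM => //; exact: continuous_fun_cst.
Qed.

Lemma sobolev_sup_le a : `|du a - dv a| <= 4 * pi * N.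
Proof.
have N0 : 0 <= N by rewrite mulr_ge0 ?L2_to_L1_ge0 ?torus_norm2_ge0.
have p0 := @pi_gt0 R.
rewrite -[du a - dv a]/(g a) -[a]addr0.
apply: (@approx_identity R (fun s => g (a + s))).
- by move=> s; exact: continuous_at_shift.
- by apply: (mulr_ge0 _ N0); rewrite mulr_ge0// ltW.
- by move=> s; rewrite addrA g_p.
move=> nu nu0; have [H0 [H1 [H0E H1E H0p H0b H1b]]] := green_function nu0.
rewrite (pairing a nu0 H0E H1E H0p) normrM gtr0_norm ?peak_mass_gt0//.
rewrite [leRHS]mulrC ler_pM2l ?peak_mass_gt0//.
apply: L2_pairing_le => //.
by apply: continuous_funBr; exact: derive_continuous H0E.
Qed.

(** The second derivative of u - v is never formed: the smoothed Green function is 2-Lipschitz, and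
    this passes to g through the pairings at a and b. *)
Lemma sobolev_lipschitz a b :
  `|(du a - dv a) - (du b - dv b)| <= 2 * `|a - b| * N.
Proof.
have N0 : 0 <= N by rewrite mulr_ge0 ?L2_to_L1_ge0 ?torus_norm2_ge0.
rewrite -[_ - _ - _]/(g a - g b) -{1}[a]addr0 -{1}[b]addr0.
have gc c : continuous (fun s => g (c + s)) by move=> s; exact: continuous_at_shift.
apply: (@approx_identity R (fun s => g (a + s) - g (b + s))).
- exact: continuous_funB.
- by apply: (mulr_ge0 _ N0); rewrite mulr_ge0.
- by move=> s; rewrite [a + (s + _)]addrA [b + (s + _)]addrA !g_p.
move=> nu nu0; have [H0 [H1 [H0E H1E H0p H0b H1b]]] := green_function nu0.
have kc := peak_continuous nu0; have H0c := derive_continuous H0E.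
have -> : (fun y => (g (a + y) - g (b + y)) * peak nu y) =
    (fun y => g (a + y) * peak nu y - g (b + y) * peak nu y).
  by apply/funext => y; rewrite mulrBl.
rewrite torus_intB; [|exact: continuous_funM..].
rewrite (pairing a nu0 H0E H1E H0p) (pairing b nu0 H0E H1E H0p) -mulrBr.
rewrite normrM gtr0_norm ?peak_mass_gt0// [leRHS]mulrC ler_pM2l ?peak_mass_gt0//.
have i c := L2_pairing_integrable W2 (continuous_funBr (c := c) H0c) (fun x => H0b (x - c)).
rewrite /torus_int -RintegralB; [|exact: measurable_torus|exact: i|exact: i].
rewrite (_ : (fun x => W x * H0 (x - a) - W x * H0 (x - b)) =
  (fun x => W x * (H0 (x - a) - H0 (x - b)))); last first.
  by apply/funext => x; rewrite mulrBr.
apply: L2_pairing_le => //; first by apply: continuous_funB; exact: continuous_funBr.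
move=> x; have := lipschitz_of_derive H0E H1b (x - b) (x - a).
rewrite (_ : x - a - (x - b) = b - a); last by ring.
by rewrite [`|b - a|]distrC.
Qed.

End Difference.
End SobolevEmbedding.

(** * Regularity of the slope in time *)

Section TimeRegularity.
Context {R : realType}.

Lemma L2_0 : L2 (fun _ : R => 0).
Proof.
split; last exact: measurable_cst.
by rewrite /finite_norm (_ : EFin \o _ = cst 0%E)// Lnorm0// ltry.
Qed.

Lemma torus_int0 : torus_int (fun _ : R => 0) = 0.
Proof. by rewrite torus_int_cst mulr0. Qed.

Lemma sobolev_jet0 m : sobolev_jet m (fun _ : R => 0) (fun _ _ => 0).
Proof.
split=> // k _; first exact: L2_0.
move=> phi _ _ _.
have e (g : R -> R) : (fun x => 0 * g x) = fun _ => 0.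
  by apply/funext => x; rewrite mul0r.
by rewrite !e torus_int0 oppr0.
Qed.

Lemma le_sobolev_norm m (D : nat -> R -> R) k : (k <= m)%N ->
  torus_norm 2%:E (D k) <= sobolev_norm m D.
Proof.
move=> km; rewrite -[leLHS]ger0_norm ?torus_norm2_ge0// -sqrtr_sqr ler_wsqrtr//.
have km' : (k < m.+1)%N by [].
rewrite (bigD1 (Ordinal km'))//= lerDl sumr_ge0// => i _; exact: sqr_ge0.
Qed.

Variables (T : R) (f : R -> R -> R).
Hypothesis f_per : forall t, t \in `[0, T] -> periodic (f t) (pi *+ 2).
Hypothesis f_sob : continuous_in_sobolev 3 T f.
Hypothesis f_der : forall t x, t \in `[0, T] -> derivable (f t) x 1.
Hypothesis f_dc : forall t, t \in `[0, T] -> continuous (derive1 (f t)).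

Lemma slopeE t : t \in `[0, T] -> forall x, deriv_at (f t) x (derive1 (f t) x).
Proof. by move=> tT x; apply: derivable_deriv_at; exact: f_der. Qed.

Lemma slope_time_continuity t : t \in `[0, T] -> forall e, 0 < e ->
  exists2 d, 0 < d & forall s, s \in `[0, T] -> `|s - t| < d ->
    (forall x, `|derive1 (f s) x - derive1 (f t) x| <= e) /\
    (forall x y, `|(derive1 (f s) x - derive1 (f t) x)
                 - (derive1 (f s) y - derive1 (f t) y)| <= e * `|x - y|).
Proof.
move=> tT e e0; have [D [jetD /(_ t tT) cvD]] := f_sob.
have p0 := @pi_gt0 R; have L0 := @L2_to_L1_ge0 R.
(* The constants of the sup bound and of the Lipschitz bound added up, so that one e serves both;
   the 1 keeps C positive. *)
pose C := 4 * pi * (L2_to_L1 : R) + 2 * L2_to_L1 + 1.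
have pL : 0 <= pi * (L2_to_L1 : R) by rewrite mulr_ge0// ltW.
have C0 : 0 < C by rewrite /C; lra.
have eC : 0 < e / C by rewrite divr_gt0.
have /cvgrPdist_le/(_ _ eC) := cvD.
rewrite near_withinE => /nbhs_ballP[d d0 dP]; exists d => // s sT st.
have st' : ball t d s by rewrite /ball/= distrC.
have := dP s st' sT; rewrite sub0r normrN => H.
have {}H : torus_norm 2%:E (fun x => D s 3%N x - D t 3%N x) <= e / C.
  apply: le_trans (le_trans (ler_norm _) H).
  exact: (@le_sobolev_norm 3 (fun k x => D s k x - D t k x) 3).
have CH : C * torus_norm 2%:E (fun x => D s 3%N x - D t 3%N x) <= e.
  by move: H; rewrite ler_pdivlMr// mulrC.
have N0 := torus_norm2_ge0 (fun x => D s 3%N x - D t 3%N x).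
have sup x := sobolev_sup_le (jetD s sT) (jetD t tT) (slopeE sT) (slopeE tT)
  (f_dc sT) (f_dc tT) (f_per sT) (f_per tT) x.
have lip x y := sobolev_lipschitz (jetD s sT) (jetD t tT) (slopeE sT) (slopeE tT)
  (f_dc sT) (f_dc tT) (f_per sT) (f_per tT) x y.
move: CH N0 sup lip; rewrite /C; move: (torus_norm _ _) (L2_to_L1) L0 pL => N L L0 pL.
move=> CH N0 sup lip.
have pLN := mulr_ge0 pL N0; have LN := mulr_ge0 L0 N0.
split=> [x|x y]; first by apply: le_trans (sup x) _; lra.
apply: le_trans (lip x y) _; rewrite mulrAC ler_wpM2r//; lra.
Qed.

(** The difference estimate, applied to f t and the zero function. *)
Lemma slope_lipschitz t : t \in `[0, T] -> exists2 K, 0 <= K &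
  forall x y, `|derive1 (f t) x - derive1 (f t) y| <= K * `|x - y|.
Proof.
move=> tT; have [D [jetD _]] := f_sob.
exists (2 * (L2_to_L1 * torus_norm 2%:E (fun x => D t 3%N x - 0))).
  by rewrite !mulr_ge0 ?L2_to_L1_ge0 ?torus_norm2_ge0.
move=> x y.
have := sobolev_lipschitz (jetD t tT) (sobolev_jet0 3) (slopeE tT)
  (fun x => deriv_at_cst 0 x) (f_dc tT) (@continuous_fun_cst R 0) (f_per tT)
  (fun _ => erefl) x y.
by rewrite !subr0 mulrAC.
Qed.

(** The difference of slopes at nearby times is 1-Lipschitz in x, so a constant valid at t stays
    valid near t once increased by 1; compactness of the time interval does the rest. *)
Lemma slope_lipschitz_uniform : exists2 K, 0 <= K &
  forall t, t \in `[0, T] -> forall x y,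
    `|derive1 (f t) x - derive1 (f t) y| <= K * `|x - y|.
Proof.
pose P (K t : R) := forall x y,
    `|derive1 (f t) x - derive1 (f t) y| <= K * `|x - y|.
have cov : near_covering (`[0, T]%classic : set R).
  by apply/compact_near_coveringP; exact: segment_compact.
have [M [_ MP]] : \forall M \near +oo,
    (`[0, T]%classic : set R) `<=` (fun s => s \in `[0, T] -> P M s).
  apply: (cov _ (pinfty_nbhs R) (fun K s => s \in `[0, T] -> P K s)).
  move=> t /= tT; have [K K0 KP] := slope_lipschitz tT.
  have [d d0 dP] := slope_time_continuity tT ltr01.
  exists ([set s | `|s - t| < d], [set M | K + 1 <= M]) => /=.
    split; last by apply: nbhs_pinfty_ge; exact: num_real.
    apply/nbhs_ballP; exists d => // s; rewrite /ball/= distrC; exact.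
  move=> [s M] /= [st KM] sT x y.
  have [_ lip] := dP s sT st.
  have -> : derive1 (f s) x - derive1 (f s) y =
    (derive1 (f s) x - derive1 (f t) x - (derive1 (f s) y - derive1 (f t) y))
    + (derive1 (f t) x - derive1 (f t) y) by ring.
  apply: le_trans (ler_normD _ _) _; have := lip x y; have := KP x y.
  have := ler_wpM2r (normr_ge0 (x - y)) KM; lra.
exists (`|M| + 1); first by have := normr_ge0 M; lra.
move=> t tT x y; apply: (MP (`|M| + 1)) => //.
by have := ler_norm M; lra.
Qed.

End TimeRegularity.

(** * Decay of the slope *)

Section Barrier.
Context {R : realType}.

Lemma eps_continuous_within (g : R -> R) (a b : R) :
  (forall t, a <= t <= b -> forall e, 0 < e -> exists2 d, 0 < d &
     forall s, a <= s <= b -> `|s - t| < d -> `|g s - g t| <= e) ->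
  {within `[a, b], continuous g}.
Proof.
move=> H; apply/subspace_continuousP => t /=; rewrite in_itv/= => tab.
apply/cvgrPdist_le => e e0; have [d d0 dP] := H t tab e e0.
rewrite near_withinE; apply/nbhs_ballP; exists d => // s st /=.
rewrite in_itv/= => sab; rewrite distrC; apply: dP => //.
by move: st; rewrite /ball/= distrC.
Qed.

Lemma eps_of_within (g : R -> R) (a : R) : {within `[0, a], continuous g} ->
  forall t, 0 <= t <= a -> forall e, 0 < e -> exists2 d, 0 < d &
     forall s, 0 <= s <= a -> `|s - t| < d -> `|g s - g t| <= e.
Proof.
move=> /subspace_continuousP gc t tab e e0.
have tI : `[0, a]%classic t by rewrite /= in_itv.
have /cvgrPdist_le/(_ _ e0) := gc t tI.
rewrite near_withinE => /nbhs_ballP[d d0 dP]; exists d => // s sab st.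
rewrite distrC; apply: dP => /=; last by rewrite in_itv.
by rewrite /ball/= distrC.
Qed.

Lemma first_crossing (g : R -> R) (a b c : R) : a <= b ->
  (forall t, a <= t <= b -> forall e, 0 < e -> exists2 d, 0 < d &
     forall s, a <= s <= b -> `|s - t| < d -> `|g s - g t| <= e) ->
  g a < c -> c <= g b ->
  exists t, [/\ a < t, t <= b, g t = c & forall s, a <= s <= t -> g s <= c].
Proof.
move=> ab gc ga gb; pose A := [set t : R | a <= t <= b /\ c <= g t].
have bA : A b by split=> //; rewrite ab lexx.
have lbA : lbound A a by move=> t [/andP[]].
have infA : has_inf A by split; [exists b|exists a].
pose t := inf A.
have ta : a <= t by apply: lb_le_inf => //; exists b.
have tb : t <= b by apply: ge_inf bA; exists a.
have tab : a <= t <= b by rewrite ta tb.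
have below s : a <= s -> s < t -> g s < c.
  move=> as_ st; rewrite ltNge; apply/negP => cs.
  have : t <= s.
    by apply: ge_inf; [exists a|split=> //; rewrite as_ (le_trans (ltW st) tb)].
  by rewrite leNgt st.
have gt_ge : c <= g t.
  rewrite leNgt; apply/negP => gtc.
  have e0 : 0 < (c - g t) / 2 by rewrite divr_gt0// subr_gt0.
  have [d d0 dP] := gc t tab _ e0.
  have [s [sab cs] sd] := inf_adherent d0 infA.
  have ts : t <= s by apply: ge_inf; [exists a|split].
  have := dP s sab; rewrite ger0_norm ?subr_ge0// ltrBlDl => /(_ sd).
  by move=> /ler_normlP[_]; lra.
have at_ : a < t.
  by rewrite lt_neqAle ta andbT; apply: contraTneq gt_ge => <-; rewrite -ltNge.
have gt_le : g t <= c.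
  rewrite leNgt; apply/negP => gtc.
  have e0 : 0 < (g t - c) / 2 by rewrite divr_gt0// subr_gt0.
  have [d d0 dP] := gc t tab _ e0.
  pose s := Num.max a (t - d / 2).
  have s1 : a <= s by rewrite le_max lexx.
  have s2 : t - d / 2 <= s by rewrite le_max lexx orbT.
  have st : s < t by rewrite gt_max at_/= ltrBlDr ltrDl divr_gt0.
  have sab : a <= s <= b by rewrite s1 (le_trans (ltW st)).
  have sd : `|s - t| < d by rewrite ltr0_norm ?subr_lt0//; lra.
  by have /ler_normlP[] := dP s sab sd; have := below s s1 st; lra.
exists t; split=> //; first by apply/eqP; rewrite eq_le gt_le.
move=> s /andP[as_]; rewrite le_eqVlt => /predU1P[->//|st].
exact: ltW (below s as_ st).
Qed.

End Barrier.

(** * Increments against slopes *)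

Section Increments.
Context {R : realType}.
Variables (T h : R) (f : R -> R -> R) (Lam : R).
Hypothesis f_per : forall t, t \in `[0, T] -> periodic (f t) (pi *+ 2).
Hypothesis fE : forall t, t \in `[0, T] -> forall x, deriv_at (f t) x (derive1 (f t) x).
Hypothesis f_dc : forall t, t \in `[0, T] -> continuous (derive1 (f t)).
Hypothesis f_lip : forall t, t \in `[0, T] -> forall x y,
    `|derive1 (f t) x - derive1 (f t) y| <= Lam * `|x - y|.

Definition increment (t x : R) : R := f t (x + h) - f t x.

Lemma slope_le t x : t \in `[0, T] -> `|derive1 (f t) x| <= normLoo (derive1 (f t)).
Proof.
move=> tT; apply: normLoo_ge; first exact: f_dc.
exact: derive1_periodic (f_per tT) (fE tT).
Qed.

Lemma increment_continuous t : t \in `[0, T] -> continuous (increment t).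
Proof.
move=> tT x; apply: deriv_at_continuous.
exact: (deriv_atB (deriv_at_shift (fE tT (x + h))) (fE tT x)).
Qed.

Lemma increment_periodic t : t \in `[0, T] -> periodic (increment t) (pi *+ 2).
Proof. by move=> tT x; rewrite /increment addrAC !(f_per tT). Qed.

Lemma increment_le t x : t \in `[0, T] -> `|increment t x| <= normLoo (increment t).
Proof.
by move=> tT; apply: normLoo_ge; [exact: increment_continuous|exact: increment_periodic].
Qed.

Lemma increment_attained t : t \in `[0, T] ->
  exists x, normLoo (increment t) = `|increment t x|.
Proof.
move=> tT; have [||x _ xmax] := @periodic_max R (fun x => `|increment t x|).
- by move=> x; apply: continuous_comp; [exact: increment_continuous|exact: norm_continuous].
- by move=> x; rewrite (increment_periodic tT).
by exists x; apply/eqP; rewrite eq_le normLoo_le//= increment_le.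
Qed.

Lemma increment_norm_le t B : t \in `[0, T] -> (forall x, `|derive1 (f t) x| <= B) ->
  normLoo (increment t) <= B * `|h|.
Proof.
move=> tT fB; apply: normLoo_le => x.
have := lipschitz_of_derive (fE tT) fB x (x + h).
by rewrite [x + h - x]addrAC subrr add0r.
Qed.

Lemma increment_norm_diff s t e : s \in `[0, T] -> t \in `[0, T] ->
  (forall x, `|derive1 (f s) x - derive1 (f t) x| <= e) ->
  normLoo (increment s) <= normLoo (increment t) + e * `|h|.
Proof.
move=> sT tT st; apply: normLoo_le => x.
have := lipschitz_of_derive (fun y => deriv_atB (fE sT y) (fE tT y)) st x (x + h).
rewrite [x + h - x]addrAC subrr add0r => H.
have -> : increment s x = increment t x + (f s (x + h) - f t (x + h) - (f s x - f t x)).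
  by rewrite /increment; ring.
by apply: le_trans (ler_normD _ _) _; rewrite lerD// increment_le.
Qed.

(** Converse of [increment_norm_le]: the mean value theorem finds a point within h where the slope
    is the difference quotient, and the Lipschitz bound transports it to x. *)
Lemma slope_le_increment t : 0 < h -> t \in `[0, T] ->
  normLoo (derive1 (f t)) * h <= normLoo (increment t) + Lam * h ^+ 2.
Proof.
move=> h0 tT; rewrite -ler_pdivlMr//; apply: normLoo_le => x.
have xh : x <= x + h by rewrite lerDl ltW.
have [c [xc ch]] := mean_value (fE tT) xh.
rewrite [x + h - x]addrAC subrr add0r => e.
have Lam0 : 0 <= Lam.
  by have := le_trans (normr_ge0 _) (f_lip tT 1 0); rewrite subr0 normr1 mulr1.
rewrite ler_pdivlMr//.
have -> : derive1 (f t) x = (derive1 (f t) x - derive1 (f t) c) + derive1 (f t) c.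
  by rewrite subrK.
apply: le_trans (ler_wpM2r (ltW h0) (ler_normD _ _)) _.
rewrite mulrDl addrC lerD//.
  by rewrite -{1}(gtr0_norm h0) -normrM -e increment_le.
apply: le_trans (ler_wpM2r (ltW h0) (f_lip tT x c)) _.
rewrite expr2 mulrA ler_wpM2r ?(ltW h0)// ler_wpM2l//.
by rewrite ler0_norm; lra.
Qed.

End Increments.

Section Decay.
Context {R : realType}.
Variables (kp km rp rm h2 T : R) (f : R -> R -> R).
Hypothesis kp_gt0 : 0 < kp.
Hypothesis stable : 0 < rm - rp.
Hypothesis h2_gt0 : 0 < h2.
Hypothesis T_gt0 : 0 < T.
Hypothesis sol : smooth_muskat_solution kp km rp rm h2 T f.
Hypothesis f_gt0 : forall t x, t \in `[0, T] -> 0 < f t x.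

Let f_per := muskat_periodic sol.
Let f_dc := muskat_continuous_dx sol.
Let fE := slopeE (muskat_derivable_x sol).

Lemma weighted_continuity (g : R -> R) (mu a : R) : a <= T ->
  (forall t, t \in `[0, T] -> forall e, 0 < e -> exists2 d, 0 < d &
     forall s, s \in `[0, T] -> `|s - t| < d -> `|g s - g t| <= e) ->
  {within `[0, a], continuous (fun t => g t * expR (mu * t))}.
Proof.
move=> aT gc t; apply: cvgM.
  apply: (@eps_continuous_within R g 0 a) => {}t tab e e0.
  have sub s : 0 <= s <= a -> s \in `[0, T].
    by move=> /andP[s0 sa]; rewrite in_itv/= s0 (le_trans sa).
  have [d d0 dP] := gc t (sub _ tab) e e0.
  by exists d => // s sab; apply: dP; exact: sub.
have ec : continuous (fun t : R => expR (mu * t)).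
  apply: (@continuous_fun_comp R expR); first exact: continuous_expR.
  by apply: continuous_funM => [|y]; [exact: continuous_fun_cst|exact: cvg_id].
exact: (continuous_subspaceT ec).
Qed.

Lemma slope_norm_continuity t : t \in `[0, T] -> forall e, 0 < e ->
  exists2 d, 0 < d & forall s, s \in `[0, T] -> `|s - t| < d ->
    `|normLoo (derive1 (f s)) - normLoo (derive1 (f t))| <= e.
Proof.
move=> tT e e0.
have [d d0 dP] := slope_time_continuity f_per (muskat_sobolev sol)
  (muskat_derivable_x sol) f_dc tT e0.
exists d => // s sT st; have [st' _] := dP s sT st.
have aux (a b : R) : a \in `[0, T] -> b \in `[0, T] ->
    (forall x, `|derive1 (f a) x - derive1 (f b) x| <= e) ->
    normLoo (derive1 (f a)) <= normLoo (derive1 (f b)) + e.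
  move=> aT bT ab; apply: normLoo_le => x.
  rewrite -[derive1 (f a) x](subrK (derive1 (f b) x)) addrC.
  apply: le_trans (ler_normD _ _) _; apply: lerD (ab x).
  exact: (slope_le f_per fE f_dc).
have ts x : `|derive1 (f t) x - derive1 (f s) x| <= e by rewrite distrC.
have := aux _ _ sT tT st'; have := aux _ _ tT sT ts.
by rewrite ler_norml; lra.
Qed.

Lemma increment_norm_continuity h t : t \in `[0, T] -> forall e, 0 < e ->
  exists2 d, 0 < d & forall s, s \in `[0, T] -> `|s - t| < d ->
    `|normLoo (increment h f s) - normLoo (increment h f t)| <= e.
Proof.
move=> tT e e0; have h1 : 0 < `|h| + 1 by have := normr_ge0 h; lra.
have eh : 0 < e / (`|h| + 1) by rewrite divr_gt0.
have [d d0 dP] := slope_time_continuity f_per (muskat_sobolev sol)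
  (muskat_derivable_x sol) f_dc tT eh.
exists d => // s sT st; have [st' _] := dP s sT st.
have ts x : `|derive1 (f t) x - derive1 (f s) x| <= e / (`|h| + 1) by rewrite distrC.
have le_e : e / (`|h| + 1) * `|h| <= e.
  by rewrite mulrAC ler_pdivrMr// ler_pM2l//; lra.
have := increment_norm_diff h f_per fE sT tT st'.
have := increment_norm_diff h f_per fE tT sT ts.
by rewrite ler_norml; lra.
Qed.

(* At the maximum the time derivative of the weighted increment is nonnegative,
   whereas the equation bounds it by the negative decay plus an error in h^2. *)
Lemma increment_maximum (Lam mu h z ts : R) : 0 < h -> 0 <= mu ->
  (forall t, t \in `[0, T] -> forall x y,
    `|derive1 (f t) x - derive1 (f t) y| <= Lam * `|x - y|) ->
  0 < ts -> ts < T ->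
  (forall s, 0 <= s <= ts -> normLoo (increment h f s) * expR (mu * s) <=
                             normLoo (increment h f ts) * expR (mu * ts)) ->
  normLoo (derive1 (f ts)) <= z -> 0 <= damping z ->
  (decay_rate kp km rp rm h2 z - mu) * normLoo (increment h f ts) <=
  pi * `|calA kp km rp rm| * (1 + z ^+ 2) / (sinh h2 * (cosh h2 - 1)) * Lam * h ^+ 2.
Proof.
move=> h0 mu0 f_lip ts0 tsT tsmax Lz dz; have p0 := @pi_gt0 R.
have sub s : 0 <= s <= ts -> s \in `[0, T].
  by move=> /andP[s0 sa]; rewrite in_itv/= s0 (le_trans sa)// ltW.
have tsI : ts \in `[0, T] by apply: sub; rewrite lexx ltW.
have tsO : ts \in `]0, T[ by rewrite in_itv/= ts0.
set N := normLoo (increment h f ts); set Z := normLoo (derive1 (f ts)) in Lz.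
have N0 : 0 <= N := normLoo_ge0 _; have Z0 : 0 <= Z := normLoo_ge0 _.
(* If the increment of largest modulus is negative, stepping backwards from its right end point
   makes it positive; only maxima need then be treated, for a step of either sign. *)
have [h' [x [h'E wx wle]]] : exists h' x, [/\ `|h'| = h,
    f ts (x + h') - f ts x = N &
    forall s y, s \in `[0, T] -> f s (y + h') - f s y <= normLoo (increment h f s)].
  have [x0 x0N] := increment_attained h f_per fE tsI.
  have [w0|w0] := leP 0 (increment h f ts x0).
    exists h, x0; split; first by rewrite gtr0_norm.
      by rewrite /N x0N ger0_norm.
    move=> s y sI; apply: le_trans (ler_norm _) _.
    exact: (increment_le h f_per fE y sI).
  exists (- h), (x0 + h); split; first by rewrite normrN gtr0_norm.
    by rewrite /N x0N ltr0_norm// /increment addrK opprB.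
  move=> s y sI; apply: le_trans (ler_norm _) _.
  have := increment_le h f_per fE (y - h) sI.
  by rewrite /increment subrK distrC.
pose X s := expR (mu * s); have X0 s : 0 < X s by exact: expR_gt0.
have XE : deriv_at X ts (X ts * mu).
  apply: (deriv_at_comp (f := expR) (g := fun s => mu * s)).
    exact: is_derive_expR.
  have := deriv_atM (deriv_at_cst mu ts) (deriv_at_id ts).
  by rewrite mul0r add0r mulr1.
have dt y : deriv_at (fun s => f s y) ts (derive1 (f ^~ y) ts).
  exact/derivable_deriv_at/(muskat_derivable_t sol).
have phiE := deriv_atM (deriv_atB (dt (x + h')) (dt x)) XE.
(* The pair x, x + h' stays fixed as s varies: the norm at time s dominates its increment, with
   equality at [ts], so maximality passes from the norm to this increment. *)
have := deriv_at_left_max phiE ts0 _ => /(_ _)/wrap[|].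
  move=> s sts; have sI := sub s sts.
  apply: (le_trans (y := normLoo (increment h f s) * X s)).
    by rewrite ler_pM2r// wle.
  by rewrite wx; exact: tsmax.
rewrite wx mulrCA [_ * X ts]mulrC -mulrDr pmulr_rge0// => dw.
move: dw; rewrite !(muskat_equation sol)// => dw.
have duZ y : `|derive1 (f ts) y| <= Z by exact: (slope_le f_per fE f_dc).
have dZ : 0 <= damping Z := le_trans dz (damping_nonincreasing Z0 Lz).
have x_max y : f ts (y + h') - f ts y <= f ts (x + h') - f ts x by rewrite wx wle.
have := muskat_rhs_diff_le km (mulr_gt0 kp_gt0 stable) h2_gt0 (fE tsI) (f_per tsI)
  (f_dc tsI) duZ (f_lip ts tsI) (fun y => f_gt0 y tsI) dZ x_max.
rewrite wx h'E => rhs.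
have k0 : 0 < kp * (rm - rp) / 4 by rewrite divr_gt0// mulr_gt0.
have c0 : 0 < cosh h2 - 1 by rewrite subr_gt0 cosh_gt1.
have B_mono : pi * `|calA kp km rp rm| * (1 + Z ^+ 2) / (sinh h2 * (cosh h2 - 1)) <=
    pi * `|calA kp km rp rm| * (1 + z ^+ 2) / (sinh h2 * (cosh h2 - 1)).
  rewrite ler_pM2r; last by rewrite invr_gt0 mulr_gt0// sinh_gt0.
  apply: ler_wpM2l; first exact: (mulr_ge0 (ltW p0) (normr_ge0 _)).
  by rewrite lerD2l lerXn2r ?nnegrE// (le_trans Z0).
have B0 : 0 <= pi * `|calA kp km rp rm| * (1 + z ^+ 2) / (sinh h2 * (cosh h2 - 1)).
  apply: divr_ge0; last exact: (mulr_ge0 (ltW (sinh_gt0 h2_gt0)) (ltW c0)).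
  apply: mulr_ge0; first exact: (mulr_ge0 (ltW p0) (normr_ge0 _)).
  by rewrite addr_ge0// sqr_ge0.
have Zh := slope_le_increment f_per fE f_lip h0 tsI.
rewrite -/Z -/N in Zh.
rewrite /decay_rate; move: B_mono B0 rhs.
set B := _ / _; set Bz := _ / (sinh h2 * (cosh h2 - 1)) => B_mono B0 rhs.
(* [t1] and [t3] pass from the actual slope Z to its bound z in both parts of the rate; [t2] trades
   Z h for N, which is where the error in h^2 appears. *)
have t1 := ler_wpM2r (mulr_ge0 Z0 (ltW h0)) B_mono.
have t2 := ler_wpM2l B0 Zh.
have t3 := ler_wpM2r N0 (ler_wpM2l (ltW k0) (damping_nonincreasing Z0 Lz)).
clearbody B Bz; move: (damping Z) (damping z) t1 t2 t3 rhs dw => dZ' dz' t1 t2 t3 rhs dw.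
clear - t1 t2 t3 rhs dw; lra.
Qed.

Lemma slope_decay (mu : R) : 0 < mu ->
  0 < normLoo (derive1 (f 0)) ->
  mu < decay_rate kp km rp rm h2 (normLoo (derive1 (f 0))) ->
  forall t, t \in `[0, T] ->
    normLoo (derive1 (f t)) <= normLoo (derive1 (f 0)) * expR (- mu * t).
Proof.
set z0 := normLoo (derive1 (f 0)) => mu0 z0p muz t tI.
pose L s := normLoo (derive1 (f s)); pose X s := expR (mu * s).
have X0 s : 0 < X s by exact: expR_gt0.
have X1 : X 0 = 1 by rewrite /X mulr0 expR0.
have X_mono s s' : s <= s' -> X s <= X s' by move=> ss; rewrite ler_expR ler_pM2l.
rewrite mulNr expRN -/(X t) -/(L t) ler_pdivlMr// leNgt; apply/negP => Lt.
have Lc : {within `[0, T], continuous (fun s => L s * X s)}.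
  by apply: weighted_continuity => // s sI e e0; exact: slope_norm_continuity.
(* The equation holds only at interior times, so a violation at T itself is first moved to an
   earlier time by continuity. *)
have [t0 [t00 t0T Lt0]] : exists t0, [/\ 0 < t0, t0 < T & z0 < L t0 * X t0].
  move: (tI); rewrite in_itv/= => /andP[]; rewrite le_eqVlt => /predU1P[t0|t0 _].
    by move: Lt; rewrite -t0 X1 mulr1 /L -/z0 ltxx.
  have [tT|Tt] := ltP t T; first by exists t.
  have {Tt}tT : t = T by apply/eqP; rewrite eq_le Tt andbT; move: tI; rewrite in_itv => /andP[].
  rewrite tT in Lt; have e0 : 0 < (L T * X T - z0) / 2 by rewrite divr_gt0// subr_gt0.
  have TI : 0 <= T <= T by rewrite lexx ltW.
  have [d d0 dP] := eps_of_within Lc TI e0.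
  pose s := Num.max (T / 2) (T - d / 2).
  have s1 : T / 2 <= s by rewrite le_max lexx.
  have s2 : T - d / 2 <= s by rewrite le_max lexx orbT.
  have sT : s < T by rewrite gt_max ltrBlDr ltrDl divr_gt0// andbT; lra.
  have s0 : 0 < s by apply: lt_le_trans s1; rewrite divr_gt0.
  have sd : `|s - T| < d by rewrite ltr0_norm ?subr_lt0//; lra.
  have sI : 0 <= s <= T by rewrite !ltW.
  by exists s; split=> //; have /ler_normlP[] := dP s sI sd; lra.
have t0I : 0 <= t0 by exact: ltW.
have [e1 e10 mue] := decay_rate_perturb muz.
set z1 := z0 + e1 in mue; have z01 : z0 < z1 by rewrite ltrDl.
(* The crossing level: above the initial slope, which leaves a margin for the error of the
   increments; at most [z1], so that the rate remains good up to the crossing; and actually reached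
   by time [t0]. *)
pose z2 := Num.min z1 (L t0 * X t0).
have z02 : z0 < z2 by rewrite lt_min z01.
have z21 : z2 <= z1 by rewrite ge_min lexx.
have z2L : z2 <= L t0 * X t0 by rewrite ge_min lexx orbT.
have L0X : L 0 * X 0 < z2 by rewrite X1 mulr1.
have Lct0 := weighted_continuity (ltW t0T) slope_norm_continuity (mu := mu).
have [t1 [t10 t1t0 Lt1 Lbelow]] := first_crossing t0I (eps_of_within Lct0) L0X z2L.
have t1T : t1 < T := le_lt_trans t1t0 t0T.
have [Lam Lam0 f_lip] := slope_lipschitz_uniform f_per (muskat_sobolev sol)
  (muskat_derivable_x sol) f_dc.
pose B := pi * `|calA kp km rp rm| * (1 + z1 ^+ 2) / (sinh h2 * (cosh h2 - 1)).
have p0 := @pi_gt0 R.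
have c0 : 0 < cosh h2 - 1 by rewrite subr_gt0 cosh_gt1.
have B0 : 0 <= B.
  apply: divr_ge0; last exact: (mulr_ge0 (ltW (sinh_gt0 h2_gt0)) (ltW c0)).
  apply: mulr_ge0; first exact: (mulr_ge0 (ltW p0) (normr_ge0 _)).
  by rewrite addr_ge0// sqr_ge0.
pose gap := decay_rate kp km rp rm h2 z1 - mu.
have gap0 : 0 < gap by rewrite subr_gt0.
have k0 : 0 < kp * (rm - rp) / 4 by rewrite divr_gt0// mulr_gt0.
have dz1 : 0 <= damping z1.
  rewrite -(pmulr_rge0 _ k0).
  have : 0 < decay_rate kp km rp rm h2 z1 by exact: lt_trans mue.
  by rewrite /decay_rate -/B subr_gt0 => /ltW; exact: le_trans.
pose XT := X T; have XT0 : 0 < XT := X0 T.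
(* [hA] keeps the error of [slope_le_increment] below the margin z2 - z0, [hB] the error of
   [increment_maximum] below its decay; the summands 1 in the denominators below cover Lam = 0 and B
   = 0. *)
have [h [h0 hA hB]] : exists h, [/\ 0 < h, Lam * h * XT < z2 - z0 &
    B * Lam * h * XT < gap * z0].
  pose a := (z2 - z0) / ((Lam + 1) * XT).
  pose b := gap * z0 / ((B + 1) * (Lam + 1) * XT).
  have La : 0 < Lam + 1 by rewrite ltr_wpDl.
  have Ba : 0 < B + 1 by rewrite ltr_wpDl.
  have LX : 0 < (Lam + 1) * XT by exact: mulr_gt0.
  have BLX : 0 < (B + 1) * (Lam + 1) * XT by rewrite !mulr_gt0.
  have a0 : 0 < a by rewrite divr_gt0// subr_gt0.
  have b0 : 0 < b by rewrite divr_gt0// mulr_gt0.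
  exists (Num.min a b); set h := Num.min a b.
  have h0 : 0 < h by rewrite lt_min a0.
  have ha : h <= a by rewrite ge_min lexx.
  have hb : h <= b by rewrite ge_min lexx orbT.
  have hXT : 0 < h * XT by exact: mulr_gt0.
  split=> //.
    move: ha; rewrite ler_pdivlMr// => ha; apply: lt_le_trans ha.
    by rewrite (_ : h * _ = Lam * h * XT + h * XT) ?ltrDl//; ring.
  move: hb; rewrite ler_pdivlMr// => hb; apply: lt_le_trans hb.
  have BL : 0 <= B * (h * XT) by rewrite mulr_ge0// ltW.
  have LL : 0 <= Lam * (h * XT) by rewrite mulr_ge0// ltW.
  rewrite (_ : h * _ = B * Lam * h * XT + (B * (h * XT) + Lam * (h * XT) + h * XT)); last by ring.
  by rewrite ltrDl ltr_wpDl// addr_ge0.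
pose N s := normLoo (increment h f s).
have Nc := weighted_continuity (ltW t1T) (increment_norm_continuity h) (mu := mu).
have [ts tsI tsmax] := EVT_max (ltW t10) Nc.
move: tsI; rewrite in_itv/= => /andP[ts0 tst1].
have tsT : ts < T := le_lt_trans tst1 t1T.
have I0 : 0 \in `[0, T] by rewrite in_itv/= lexx ltW.
have I1 : t1 \in `[0, T] by rewrite in_itv/= !ltW.
have Is : ts \in `[0, T] by rewrite in_itv/= ts0 ltW.
have N0 : N 0 <= z0 * h.
  have slope0 x : `|derive1 (f 0) x| <= z0 := slope_le f_per fE f_dc x I0.
  by have := increment_norm_le h fE I0 slope0; rewrite (gtr0_norm h0).
(* At the crossing time the weighted slope is z2, so the weighted increment exceeds h z0, whereas at
   time 0 it is at most h z0. Hence the maximum over [0, t1] is not attained at time 0. *)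
have N1 : h * z0 < N t1 * X t1.
  have := slope_le_increment f_per fE f_lip h0 I1; rewrite -/(L t1) -/(N t1) => H.
  have := ler_wpM2r (ltW (X0 t1)) H; rewrite mulrAC Lt1 mulrDl => {}H.
  have H2 : Lam * h ^+ 2 * X t1 <= h * (Lam * h * XT).
    rewrite (_ : h * _ = Lam * h ^+ 2 * XT); last by ring.
    by apply: ler_wpM2l; [rewrite mulr_ge0 ?sqr_ge0|exact: (X_mono _ _ (ltW t1T))].
  have H3 : h * (Lam * h * XT) < h * (z2 - z0) by rewrite ltr_pM2l.
  by move: H H2 H3; rewrite mulrBr [z2 * h]mulrC; lra.
have Nts : h * z0 < N ts * X ts.
  by apply: lt_le_trans N1 _; apply: tsmax; rewrite in_itv/= lexx ltW.
have ts_gt0 : 0 < ts.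
  rewrite lt_neqAle ts0 andbT; apply: contraTneq Nts => <-.
  by rewrite X1 mulr1 -leNgt mulrC.
have Lts : L ts <= z1.
  apply: le_trans z21; apply: le_trans (Lbelow ts _); last by rewrite ts0.
  rewrite -[leLHS]mulr1 ler_wpM2l ?normLoo_ge0//.
  by rewrite -X1 X_mono.
(* The resulting bound on gap times N is of order h^2, while N X > h z0 at the maximum; [hB] makes
   the two incompatible. *)
have := @increment_maximum Lam mu h z1 ts h0 (ltW mu0) f_lip ts_gt0 tsT _ Lts dz1.
rewrite -/B -/gap -/(N ts) => /(_ _)/wrap[|H].
  move=> s /andP[s0 sts]; apply: tsmax.
  by rewrite in_itv/= s0 (le_trans sts).
have := ler_wpM2r (ltW (X0 ts)) H.
have E1 : gap * (h * z0) < gap * N ts * X ts by rewrite -mulrA ltr_pM2l.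
have E2 : B * Lam * h ^+ 2 * X ts <= h * (B * Lam * h * XT).
  rewrite (_ : h * _ = B * Lam * h ^+ 2 * XT); last by ring.
  apply: ler_wpM2l; last exact: (X_mono _ _ (ltW tsT)).
  exact: (mulr_ge0 (mulr_ge0 B0 Lam0) (sqr_ge0 h)).
have E3 : h * (B * Lam * h * XT) < h * (gap * z0) by rewrite ltr_pM2l.
by rewrite leNgt; move: E1 E2 E3; rewrite [gap * (h * z0)]mulrCA; lra.
Qed.

End Decay.

Theorem theorem1p2 (R : realType) (kp km rp rm h2 : R) (f0 : R -> R)
    (kp_gt0 : 0 < kp) (km_gt0 : 0 < km) (stable : 0 < rm - rp) (h2_gt0 : 0 < h2)
    (f0_amplitude : amplitude_condition kp km h2 f0)
    (f0_slope : slope_condition kp km rp rm h2 f0) :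
  exists mu : R, 0 < mu /\
    forall (T : R) (f : R -> R -> R),
      0 < T ->
      smooth_muskat_solution kp km rp rm h2 T f ->
      (forall t x, t \in `[0, T] -> 0 < f t x) ->
      f 0 = f0 ->
      forall t, t \in `[0, T] ->
        normLoo (derive1 (f t)) <= normLoo (derive1 f0) * expR (- mu * t).
Proof.
have [z0 rate0] := decay_rate_gt0 kp_gt0 stable h2_gt0 f0_slope.
(* Half of the rate, because the barrier needs [mu] strictly below it; the choice involves only the
   parameters and [f0]. *)
exists (decay_rate kp km rp rm h2 (normLoo (derive1 f0)) / 2); split.
  by rewrite divr_gt0.
move=> T f T0 sol f_gt0 f0E; rewrite -f0E in z0 rate0 *.
apply: (slope_decay kp_gt0 stable h2_gt0 T0 sol f_gt0) => //; first by rewrite divr_gt0.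
by rewrite ltr_pdivrMr// ltr_pMr// ltr1n.
Qed.
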